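(* Suppose that $\mathcal M=\{\mathbf{x}(\omega):\omega\in\Omega\}$, where $\nabla\mathbf{x}(\omega)$ is Lipschitz-continuous and not rank-deficient on $\Omega\subset\mathbb{R}^2$. If the triangle partition $\{V_{ijk}\}$ of $\mathcal M$ satisfies $$\max_{ijk}\frac{d(V_{ijk})}{\sin\theta(V_{ijk})}\to0\quad\text{as}\quad h_V\to0,$$ then $$\inf_{f\in\mathcal F}\mathcal E_D(f)=\lim_{h\to0}\min_{f\in\mathcal F}\mathcal E_D^h(f).$$
   Context: $\mathcal M$ is a smooth simple surface embedded in $\mathbb{R}^m$ with $m\ge2$, with parameterization $\mathbf{x}:\Omega\to\mathbb{R}^m$, $\Omega\subset\mathbb{R}^2$; $\nabla\mathbf{x}(\omega)\in\mathbb{R}^{m\times2}$ is the matrix of partial derivatives. A mesh is a partition of $\Omega$, without overlaps, into finitely many nondegenerate triangles $\Omega_{ijk}$ with vertices $\omega_i,\omega_j,\omega_k$; $\mathcal M_{ijk}=\{\mathbf{x}(\omega):\omega\in\Omega_{ijk}\}$; $v_\ell=\mathbf{x}(\omega_\ell)$; $V_{ijk}$ is the triangle with vertices $v_i,v_j,v_k$, assumed nondegenerate, with area $A_{ijk}$; $v_{ij}=v_i-v_j$, $v_{jk}=v_j-v_k$, $v_{ki}=v_k-v_i$; $d(\cdot)$ is the diameter (longest side length) of a triangle and $\theta(V_{ijk})$ is the smallest angle of $V_{ijk}$. The mesh sizes are $h_\Omega=\max d(\Omega_{ijk})$ and $h_V=\max d(V_{ijk})$; one considers a family of meshes, and $h\to0$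 means $h_\Omega\to0$ or, equivalently, $h_V\to0$. $\mathbf{n}_{ijk}$ is the unit normal vector of the plane of $V_{ijk}$ in a right-hand system, with $v_{ij}\times v_{jk}=2A_{ijk}\mathbf{n}_{ijk}$, where $\times$ is the exterior (cross) product, and $b_{ijk}=[b_i,b_j,b_k]=\frac{1}{2A_{ijk}}[v_{jk}\times\mathbf{n}_{ijk},\,v_{ki}\times\mathbf{n}_{ijk},\,v_{ij}\times\mathbf{n}_{ijk}]\in\mathbb{R}^{m\times3}$; thus the barycentric coordinates of a point $p$ of the plane of $V_{ijk}$ are $\langle b_i,p-v_j\rangle$, $\langle b_j,p-v_k\rangle$, $\langle b_k,p-v_i\rangle$, and $b_{ijk}^\top\mathbf{n}_{ijk}=0$. For $f:\mathcal M\to\mathbb{R}^n$, $\nabla_{\mathcal M}f(\mathbf{x})=\nabla(f\circ\mathbf{x})(\nabla\mathbf{x}^\top\nabla\mathbf{x})^{-1}\nabla\mathbf{x}^\top\in\mathbb{R}^{n\times m}$ is the tangential gradient, where $\nabla(f\circ\mathbf{x})$ is the Jacobian of $\omega\mapsto f(\mathbf{x}(\omega))$, and $c_L(f)$ is the Lipschitz constant of $\nabla_{\mathcal M}f$: $\|\nabla_{\mathcal M}f(\mathbf{x})-\nabla_{\mathcal M}f(\hat{\mathbf{x}})\|_F\le c_L(f)\|\mathbf{x}-\hat{\mathbf{x}}\|$ on $\mathcal M$. For a given target surface $\mathcal N\subset\mathbb{R}^n$ and a positive constant $C_L$, $$\mathcal F=\{f:\ f(\mathcal M)=\mathcal N,\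 c_L(f)\le C_L\}.$$ The Dirichlet energy and its discretization are $$\mathcal E_D(f)=\frac12\int_{\mathcal M}\|\nabla_{\mathcal M}f\|_F^2\,d\sigma,\qquad\mathcal E_D^h(f)=\sum_{\mathcal M_{ijk}}\frac12\int_{\mathcal M_{ijk}}\|f_{ijk}b_{ijk}^\top\|_F^2\,d\sigma,\quad f_{ijk}=[f(v_i),f(v_j),f(v_k)],$$ with $d\sigma$ the surface area element and $\|\cdot\|_F$ the Frobenius norm. *)

(* Defs.v *)
From HB Require Import structures.
From mathcomp Require Import all_boot all_order all_algebra.
From mathcomp Require Import all_classical all_reals all_analysis.

Set Implicit Arguments.
Unset Strict Implicit.
Unset Printing Implicit Defensive.

Import Order.TTheory GRing.Theory Num.Theory.
Import numFieldNormedType.Exports.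

Local Open Scope classical_set_scope.
Local Open Scope ring_scope.

Section euclidean.
Variable R : realType.

Definition dot (m : nat) (u v : 'cV[R]_m) : R := (u^T *m v) 0 0.

(* On column vectors this is the Euclidean norm; the canonical norm `|_| of
   the library on matrices is the maximum norm instead. *)
Definition frob (m n : nat) (A : 'M[R]_(m, n)) : R :=
  Num.sqrt (\sum_i \sum_j A i j ^+ 2).

Definition lipschitz_with (T : Type) (D : set T) (m n p q : nat)
    (u : T -> 'M[R]_(m, n)) (v : T -> 'M[R]_(p, q)) (K : R) : Prop :=
  forall w w', D w -> D w' -> frob (u w - u w') <= K * frob (v w - v w').

(* Frechet derivative relative to D, so that it also makes sense at the
   boundary points of D.  When D is a finite union of nondegenerate closed
   triangles, a derivative relative to D is unique at every point of D. *)
Definition has_jacobian_in (m n : nat) (D : set 'cV[R]_m)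
    (g : 'cV[R]_m -> 'cV[R]_n) (w : 'cV[R]_m) (J : 'M[R]_(n, m)) : Prop :=
  forall eps : R, 0 < eps -> \forall w' \near within D (nbhs w),
    frob (g w' - g w - J *m (w' - w)) <= eps * frob (w' - w).

Definition differentiable_in (m n : nat) (D : set 'cV[R]_m)
    (g : 'cV[R]_m -> 'cV[R]_n) : Prop :=
  forall w, D w -> exists J, has_jacobian_in D g w J.

Definition jacobian_in (m n : nat) (D : set 'cV[R]_m)
    (g : 'cV[R]_m -> 'cV[R]_n) (w : 'cV[R]_m) : 'M[R]_(n, m) :=
  xget 0 [set J | has_jacobian_in D g w J].

End euclidean.

(* A triangle is the family of its three vertices, i, j, k being 0, 1, 2.
   Index arithmetic in 'I_3 is modulo 3, i.e. cyclic. *)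
Section triangle.
Variables (R : realType) (m : nat).
Implicit Type v : 'I_3 -> 'cV[R]_m.

(* edge v 0 = v_jk, edge v 1 = v_ki, edge v 2 = v_ij *)
Definition edge v (l : 'I_3) : 'cV[R]_m := v (l + 1) - v (l + 2).

Definition diam v : R := \big[Num.max/0]_(l < 3) frob (edge v l).

Definition area v : R :=
  Num.sqrt (frob (edge v 2) ^+ 2 * frob (edge v 0) ^+ 2
            - dot (edge v 2) (edge v 0) ^+ 2) / 2.

Definition angle v (l : 'I_3) : R :=
  let a := v (l + 1) - v l in
  let b := v (l + 2) - v l in
  acos (dot a b / (frob a * frob b)).

(* pi is only the neutral element: angles are at most pi. *)
Definition min_angle v : R := \big[Num.min/pi]_(l < 3) angle v l.

Definition hull v : set 'cV[R]_m :=
  [set p | exists c : 'I_3 -> R, [/\ forall l, 0 <= c l, \sum_l c l = 1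
                                   & p = \sum_l c l *: v l]].

(* The exterior product a /\ b in arbitrary dimension, as a skew-symmetric
   matrix.  If m = 3, the vector a x b corresponds to the matrix ext a b, and
     w x (a x b) = <w, b> a - <w, a> b = ext a b *m w,
   so the product of a vector w with a bivector B is B *m w. *)
Definition ext (a b : 'cV[R]_m) : 'M[R]_m := a *m b^T - b *m a^T.

Definition unit_normal v : 'M[R]_m :=
  (2 * area v)^-1 *: ext (edge v 2) (edge v 0).

Definition bary_grad v (l : 'I_3) : 'cV[R]_m :=
  (2 * area v)^-1 *: (unit_normal v *m edge v l).

Definition bary_mx v : 'M[R]_(m, 3) := \matrix_(r, l) bary_grad v l r 0.

End triangle.

Section surface.
Variables (R : realType) (m : nat).
Variables (Omega : set 'cV[R]_2) (x : 'cV[R]_2 -> 'cV[R]_m).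

Definition gram (w : 'cV[R]_2) : 'M[R]_2 :=
  (jacobian_in Omega x w)^T *m jacobian_in Omega x w.

(* The tangential gradient at the point x w, as a function of w. *)
Definition tgrad (n : nat) (f : 'cV[R]_m -> 'cV[R]_n) (w : 'cV[R]_2)
    : 'M[R]_(n, m) :=
  jacobian_in Omega (f \o x) w *m invmx (gram w) *m (jacobian_in Omega x w)^T.

Definition tgrad_lip_const (n : nat) (f : 'cV[R]_m -> 'cV[R]_n) : \bar R :=
  ereal_inf [set K%:E | K in
    [set K : R | 0 <= K /\ lipschitz_with Omega (tgrad f) x K]].

(* Maps are total functions on R^m; only their values on the surface
   x @` Omega are relevant to admissibility and to the energies. *)
Definition admissible (n : nat) (N : set 'cV[R]_n) (CL : R)
    : set ('cV[R]_m -> 'cV[R]_n) :=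
  [set f : 'cV[R]_m -> 'cV[R]_n | [/\ differentiable_in Omega (f \o x), f @` (x @` Omega) = N
             & (tgrad_lip_const f <= CL%:E)%E]].

Definition cV_of_pair (p : R * R) : 'cV[R]_2 :=
  \col_(i < 2) (if i == 0 then p.1 else p.2).

(* Integral over x @` D, for D included in Omega, against the surface area
   element sqrt (det (grad x ^T grad x)) dw; the integrand is given as a
   function of the parameter w. *)
Definition surface_integral (D : set 'cV[R]_2) (g : 'cV[R]_2 -> R) : \bar R :=
  (\int[(@lebesgue_measure R \x @lebesgue_measure R)]_(p in cV_of_pair @^-1` D)
    (g (cV_of_pair p) * Num.sqrt (\det (gram (cV_of_pair p))))%:E)%E.

Definition dirichlet (n : nat) (f : 'cV[R]_m -> 'cV[R]_n) : \bar R :=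
  (2^-1%:E * surface_integral Omega (fun w => (frob (tgrad f w) ^+ 2)%R))%E.

Record mesh := Mesh {
  mesh_card : nat;
  mesh_tri : 'I_mesh_card -> 'I_3 -> 'cV[R]_2;
  _ : forall t, 0 < area (mesh_tri t);
  _ : \bigcup_t hull (mesh_tri t) = Omega;
  _ : forall t t', t != t' ->
        (hull (mesh_tri t))° `&` (hull (mesh_tri t'))° = set0;
  _ : forall t, 0 < area (x \o mesh_tri t)
}.

Definition mesh_V (T : mesh) (t : 'I_(mesh_card T)) : 'I_3 -> 'cV[R]_m :=
  x \o mesh_tri t.

Definition h_V (T : mesh) : R :=
  \big[Num.max/0]_(t < mesh_card T) diam (mesh_V t).

Definition mesh_ratio (T : mesh) : R :=
  \big[Num.max/0]_(t < mesh_card T) (diam (mesh_V t) / sin (min_angle (mesh_V t))).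

Definition dirichlet_h (T : mesh) (n : nat) (f : 'cV[R]_m -> 'cV[R]_n)
    : \bar R :=
  (\sum_(t < mesh_card T)
     2^-1%:E * surface_integral (hull (mesh_tri t)) (fun=>
       (frob (\matrix_(r < n, l < 3) f (mesh_V t l) r 0
              *m (bary_mx (mesh_V t))^T) ^+ 2)%R))%E.

(* The filter "h_V -> 0" on the indices of a family of meshes. *)
Definition h_V_to0 (I : Type) (T : I -> mesh) : set_system I :=
  filter_from [set d : R | 0 < d] (fun d => [set i | h_V (T i) < d]).

End surface.

(* Main.v *)
Require Import Defs.
From HB Require Import structures.
From mathcomp Require Import all_boot all_order all_algebra.
From mathcomp Require Import all_classical all_reals all_analysis.
From mathcomp Require Import measurable_realfun ring lra.

Set Implicit Arguments.
Unset Strict Implicit.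
Unset Printing Implicit Defensive.

Import Order.TTheory GRing.Theory Num.Theory.
Import numFieldNormedType.Exports.

Local Open Scope classical_set_scope.
Local Open Scope ring_scope.

(** The discrete and the continuous energy differ, uniformly over the
    admissible class, by a quantity that vanishes with the mesh ratio; hence so
    do their infima.  Three facts carry this.

    Consistency.  On a triangle with vertices v_l = x(omega_l) the discrete
    gradient of f is the sum of the matrices f(v_l) b_l^T, where b_l is
    bary_grad.  Let w be a point of the parameter triangle, A the tangential
    gradient of f at w, d the diameter of the triangle of the v_l.  Since the
    b_l add up to 0, expanding both x and f o x at w turns the discrete gradient
    into A P + O(d^2 max |b_l|), where P, the sum of the v_l b_l^T, is the
    orthogonal projector onto the direction of the plane of the v_l.  Now A = A Q
    for the projector Q onto the tangent plane at w, so what remains is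
    Q (1 - P).  Both projectors have trace 2, and this makes the Frobenius norms
    of Q (1 - P) and (1 - Q) P equal (frob_proj_gap).  The latter is the sum of
    the (1 - Q) (v_l - x(w)) b_l^T, again O(d^2 max |b_l|), because 1 - Q kills
    the linear part of v_l - x(w).  In this way the triangle omega_l never has to
    be compared with the triangle v_l beyond its diameter (x_bilipschitz).
    Finally |b_l| is the inverse of a height, so d^2 |b_l| is at most
    2 d / sin theta (frob_bary_grad_le), and disc_grad_consistent follows.

    Uniformity.  The constants must not depend on f.  The gradient of f
    oscillates by at most CL times the diameter of the surface, and the values
    of f stay in one bounded set; comparing difference quotients over one fixed
    triangle bounds the gradient for the whole class (tgrad_bounded), hence also
    the Taylor remainders (adm_taylor).  As the triangles of a mesh overlap in
    null sets only (integral_mesh), integration yields energy_close.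

    Minimizers.  The discrete energy is a continuous function of the values at
    finitely many points, so it is enough that the admissible class is compact
    for pointwise convergence (adm_compact).  This is the Arzela-Ascoli argument,
    run along an ultrafilter rather than along subsequences: values and gradients
    converge at every point, and the Taylor estimate, whose constant is uniform,
    passes to the limit and makes the limit differentiable with the limit
    derivative.

    All other compactness arguments, such as the lower bounds on Dx and on the
    chords of the surface, are run along ultrafilters on nat in the same way. *)

(** * The Frobenius norm *)

Section frobenius.
Variable R : realType.

(** The inner product whose norm is frob; as a trace it makes the algebra of
    projectors available. *)
Definition ip (p q : nat) (A B : 'M[R]_(p, q)) : R := \tr (A^T *m B).

Lemma ipE p q (A B : 'M[R]_(p, q)) : ip A B = \sum_i \sum_j A i j * B i j.
Proof.
rewrite /ip /mxtrace exchange_big; apply: eq_bigr => j _; rewrite !mxE.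
by apply: eq_bigr => i _; rewrite !mxE.
Qed.

Lemma dotE m (u v : 'cV[R]_m) : dot u v = ip u v.
Proof. by rewrite /ip /mxtrace big_ord1. Qed.

Lemma ipC p q (A B : 'M[R]_(p, q)) : ip A B = ip B A.
Proof. by rewrite /ip -mxtrace_tr trmx_mul trmxK. Qed.

Lemma ipDr p q (A B C : 'M[R]_(p, q)) : ip A (B + C) = ip A B + ip A C.
Proof. by rewrite /ip mulmxDr mxtraceD. Qed.

Lemma ipDl p q (A B C : 'M[R]_(p, q)) : ip (B + C) A = ip B A + ip C A.
Proof. by rewrite ipC ipDr !(ipC A). Qed.

Lemma ipZr p q a (A B : 'M[R]_(p, q)) : ip A (a *: B) = a * ip A B.
Proof. by rewrite /ip -scalemxAr mxtraceZ. Qed.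

Lemma ipZl p q a (A B : 'M[R]_(p, q)) : ip (a *: A) B = a * ip A B.
Proof. by rewrite ipC ipZr ipC. Qed.

Lemma ipNr p q (A B : 'M[R]_(p, q)) : ip A (- B) = - ip A B.
Proof. by rewrite -scaleN1r ipZr mulN1r. Qed.

Lemma ipNl p q (A B : 'M[R]_(p, q)) : ip (- A) B = - ip A B.
Proof. by rewrite ipC ipNr ipC. Qed.

Lemma ipBr p q (A B C : 'M[R]_(p, q)) : ip A (B - C) = ip A B - ip A C.
Proof. by rewrite ipDr ipNr. Qed.

Lemma ipBl p q (A B C : 'M[R]_(p, q)) : ip (B - C) A = ip B A - ip C A.
Proof. by rewrite ipDl ipNl. Qed.

Lemma ip0r p q (A : 'M[R]_(p, q)) : ip A 0 = 0.
Proof. by rewrite /ip mulmx0 mxtrace0. Qed.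

Lemma ip0l p q (A : 'M[R]_(p, q)) : ip 0 A = 0.
Proof. by rewrite ipC ip0r. Qed.

Lemma ip_sumr p q I (r : seq I) P (A : 'M[R]_(p, q)) (F : I -> 'M[R]_(p, q)) :
  ip A (\sum_(i <- r | P i) F i) = \sum_(i <- r | P i) ip A (F i).
Proof. by elim/big_rec2: _ => [|i a B _ <-]; rewrite ?ip0r ?ipDr. Qed.

Lemma ip_mull p q r (A : 'M[R]_(p, q)) (B : 'M[R]_(q, r)) (C : 'M[R]_(p, r)) :
  ip (A *m B) C = ip B (A^T *m C).
Proof. by rewrite /ip trmx_mul mulmxA. Qed.

Lemma sqr_frob p q (A : 'M[R]_(p, q)) : frob A ^+ 2 = ip A A.
Proof.
rewrite ipE sqr_sqrtr //.
by apply: sumr_ge0 => i _; apply: sumr_ge0 => j _; rewrite sqr_ge0.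
Qed.

Lemma frob_ge0 p q (A : 'M[R]_(p, q)) : 0 <= frob A.
Proof. exact: sqrtr_ge0. Qed.
Hint Resolve frob_ge0 : core.

Lemma ip_ge0 p q (A : 'M[R]_(p, q)) : 0 <= ip A A.
Proof. by rewrite -sqr_frob sqr_ge0. Qed.

Lemma frobE p q (A : 'M[R]_(p, q)) : frob A = Num.sqrt (ip A A).
Proof. by rewrite -sqr_frob sqrtr_sqr ger0_norm. Qed.

Lemma normr_le_frob p q (A : 'M[R]_(p, q)) i j : `|A i j| <= frob A.
Proof.
rewrite -[X in _ <= X]ger0_norm // -ler_sqr ?nnegrE // !real_normK ?num_real //.
rewrite sqr_frob ipE (bigD1 i) //= (bigD1 j) //= -expr2 -addrA lerDl.
rewrite addr_ge0 //; first by apply: sumr_ge0 => k _; rewrite -expr2 sqr_ge0.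
by apply: sumr_ge0 => k _; apply: sumr_ge0 => l _; rewrite -expr2 sqr_ge0.
Qed.

Lemma frob_eq0 p q (A : 'M[R]_(p, q)) : frob A = 0 -> A = 0.
Proof.
move=> A0; apply/matrixP => i j; rewrite mxE; apply/eqP.
by rewrite -normr_eq0 eq_le normr_ge0 -A0 normr_le_frob.
Qed.

Lemma frob0 p q : frob (0 : 'M[R]_(p, q)) = 0.
Proof. by rewrite frobE ip0r sqrtr0. Qed.

Lemma frobZ p q a (A : 'M[R]_(p, q)) : frob (a *: A) = `|a| * frob A.
Proof.
rewrite !frobE ipZr ipZl mulrA -expr2 sqrtrM ?sqr_ge0 //.
by rewrite sqrtr_sqr.
Qed.

Lemma frobN p q (A : 'M[R]_(p, q)) : frob (- A) = frob A.
Proof. by rewrite -scaleN1r frobZ normrN1 mul1r. Qed.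

Lemma frobBC p q (A B : 'M[R]_(p, q)) : frob (A - B) = frob (B - A).
Proof. by rewrite -frobN opprB. Qed.

Lemma frob_tr p q (A : 'M[R]_(p, q)) : frob A^T = frob A.
Proof. by rewrite !frobE /ip trmxK mxtrace_mulC. Qed.

(** Cauchy-Schwarz, from the nonnegative norm of |B|^2 A - <A, B> B. *)
Lemma ip_le_frob p q (A B : 'M[R]_(p, q)) : ip A B <= frob A * frob B.
Proof.
have [/frob_eq0 ->|B0] := eqVneq (frob B) 0; first by rewrite ip0r frob0 mulr0.
have Bgt0 : 0 < frob B by rewrite lt_def B0 frob_ge0.
have := ip_ge0 (frob B ^+ 2 *: A - ip A B *: B).
rewrite !(ipBl, ipBr, ipZl, ipZr) -!sqr_frob (ipC B A) => H.
have {}H : 0 <= frob B ^+ 2 * ((frob A * frob B) ^+ 2 - ip A B ^+ 2) by lra.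
rewrite pmulr_rge0 ?exprn_gt0 // subr_ge0 in H.
rewrite (le_trans (ler_norm _)) // -[leRHS]ger0_norm ?mulr_ge0 //.
by rewrite -ler_sqr ?nnegrE // !real_normK ?num_real.
Qed.

Lemma norm_ip_le p q (A B : 'M[R]_(p, q)) : `|ip A B| <= frob A * frob B.
Proof. by rewrite ler_norml ip_le_frob lerNl -ipNl -(frobN A) ip_le_frob. Qed.

Lemma frobD p q (A B : 'M[R]_(p, q)) : frob (A + B) <= frob A + frob B.
Proof.
rewrite -ler_sqr ?nnegrE ?addr_ge0 // sqrrD !sqr_frob ipDl !ipDr (ipC B A).
by have := ip_le_frob A B; lra.
Qed.

Lemma frobB p q (A B : 'M[R]_(p, q)) : frob (A - B) <= frob A + frob B.
Proof. by rewrite -(frobN B) frobD. Qed.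

Lemma frob_sum p q I (r : seq I) (P : pred I) (F : I -> 'M[R]_(p, q)) :
  frob (\sum_(i <- r | P i) F i) <= \sum_(i <- r | P i) frob (F i).
Proof.
elim/big_rec2: _ => [|i a B _ IH]; first by rewrite frob0.
by apply: le_trans (frobD _ _) _; rewrite lerD2l.
Qed.

(** Each entry of A B is an inner product of a row and a column. *)
Lemma frobM p q r (A : 'M[R]_(p, q)) (B : 'M[R]_(q, r)) :
  frob (A *m B) <= frob A * frob B.
Proof.
rewrite -ler_sqr ?nnegrE ?mulr_ge0 // exprMn !sqr_frob !ipE.
rewrite -[\sum_i _ in leRHS]/(\sum_i \sum_j A i j * A i j) mulr_suml.
apply: ler_sum => i _; rewrite [in leRHS]exchange_big mulr_sumr /=.
apply: ler_sum => k _.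
have -> : (A *m B) i k = ip (row i A) (col k B)^T.
  by rewrite ipE big_ord1 mxE; apply: eq_bigr => j _; rewrite !mxE.
have -> : \sum_j A i j * A i j = frob (row i A) ^+ 2.
  by rewrite sqr_frob ipE big_ord1; apply: eq_bigr => j _; rewrite !mxE.
have -> : \sum_j B j k * B j k = frob (col k B)^T ^+ 2.
  by rewrite sqr_frob ipE big_ord1; apply: eq_bigr => j _; rewrite !mxE.
rewrite -expr2 -exprMn -real_normK ?num_real // ler_sqr ?nnegrE ?mulr_ge0 //.
exact: norm_ip_le.
Qed.

End frobenius.
#[global] Hint Extern 0 (is_true (0 <= frob _)) => exact: frob_ge0 : core.

(** * Entrywise limits of matrices *)

Lemma ultra_fmap (T U : Type) (f : T -> U) (F : set_system T) :
  UltraFilter F -> UltraFilter (f @ F).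
Proof.
move=> FU; split; first exact: fmap_proper_filter.
move=> G GF FG; rewrite predeqE => A; split; last exact: FG.
move=> GA; have [//|FnA] := in_ultra_setVsetC (f @^-1` A) FU.
have /(filterI GA) : G (~` A) by exact: FG.
by rewrite setICr => /filter_not_empty.
Qed.

Section matrix_limits.
Variable R : realType.

(** Entrywise, so that sums and products reduce to those of scalars. *)
Definition mcvg (T : Type) (U : set_system T) (p q : nat)
    (Phi : T -> 'M[R]_(p, q)) (M : 'M[R]_(p, q)) : Prop :=
  forall i j, Phi t i j @[t --> U] --> M i j.

Section filter.
Variables (T : Type) (U : set_system T).

Lemma cvg_sumr {FU : Filter U} (K : Type) (s : seq K) (f : K -> T -> R) (l : K -> R) :
  (forall k, f k t @[t --> U] --> l k) ->
  \sum_(k <- s) f k t @[t --> U] --> \sum_(k <- s) l k.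
Proof.
move=> h; elim: s => [|k s IH].
  rewrite big_nil; under eq_fun do rewrite big_nil; exact: cvg_cst.
by rewrite big_cons; under eq_fun do rewrite big_cons; apply: cvgD.
Qed.

Lemma mcvg_cst {FU : Filter U} p q (M : 'M[R]_(p, q)) : mcvg U (fun=> M) M.
Proof. by move=> i j; exact: cvg_cst. Qed.

Lemma mcvgB {FU : Filter U} p q (Phi Psi : T -> 'M[R]_(p, q)) M N :
  mcvg U Phi M -> mcvg U Psi N -> mcvg U (fun t => Phi t - Psi t) (M - N).
Proof.
move=> hM hN i j; rewrite !mxE.
under eq_fun do rewrite !mxE.
exact: cvgB.
Qed.

Lemma mcvgM {FU : Filter U} p q r (Phi : T -> 'M[R]_(p, q))
    (Psi : T -> 'M[R]_(q, r)) M N :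
  mcvg U Phi M -> mcvg U Psi N -> mcvg U (fun t => Phi t *m Psi t) (M *m N).
Proof.
move=> hM hN i j; rewrite mxE.
under eq_fun do rewrite mxE.
by apply: cvg_sumr => k; apply: cvgM.
Qed.

Lemma mcvg_tr {FU : Filter U} p q (Phi : T -> 'M[R]_(p, q)) M :
  mcvg U Phi M -> mcvg U (fun t => (Phi t)^T) M^T.
Proof.
move=> hM i j; rewrite mxE.
under eq_fun do rewrite mxE.
exact: hM.
Qed.

Lemma mcvg_sum {FU : Filter U} p q (K : Type) (s : seq K)
    (Phi : K -> T -> 'M[R]_(p, q)) M :
  (forall k, mcvg U (Phi k) (M k)) ->
  mcvg U (fun t => \sum_(k <- s) Phi k t) (\sum_(k <- s) M k).
Proof.
move=> h i j; rewrite summxE.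
under eq_fun do rewrite summxE.
by apply: cvg_sumr => k; apply: h.
Qed.

Lemma mcvg_frob {FU : Filter U} p q (Phi : T -> 'M[R]_(p, q)) M :
  mcvg U Phi M -> frob (Phi t) @[t --> U] --> frob M.
Proof.
move=> h; rewrite /frob; apply: continuous_cvg; first exact: sqrt_continuous.
apply: cvg_sumr => i; apply: cvg_sumr => j.
rewrite expr2; under eq_fun do rewrite expr2.
by apply: cvgM; apply: h.
Qed.

Lemma mcvg_frob0 {FU : Filter U} p q (Phi : T -> 'M[R]_(p, q)) M :
  frob (Phi t - M) @[t --> U] --> 0 -> mcvg U Phi M.
Proof.
move=> h i j; apply/cvgrPdist_le => e e0.
move/cvgrPdist_le: h => /(_ e e0); apply: filterS => t.
rewrite sub0r normrN ger0_norm ?frob_ge0 // => le_e; apply: le_trans le_e.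
by rewrite distrC; have := normr_le_frob (Phi t - M) i j; rewrite !mxE.
Qed.

Lemma mcvg_frob_dist {FU : Filter U} p q (Phi : T -> 'M[R]_(p, q)) M :
  mcvg U Phi M -> frob (Phi t - M) @[t --> U] --> 0.
Proof.
move=> h; rewrite -[X in _ --> X](@frob0 R p q).
by apply: mcvg_frob; rewrite -(subrr M); apply: mcvgB => //; exact: mcvg_cst.
Qed.

Lemma mcvg_le {FU : ProperFilter U} p q (Phi : T -> 'M[R]_(p, q)) M (c : T -> R) l :
  mcvg U Phi M -> c t @[t --> U] --> l ->
  (\forall t \near U, frob (Phi t) <= c t) -> frob M <= l.
Proof.
move=> /mcvg_frob hM hc h.
rewrite -subr_le0; apply: (cvgr_to_le (cvgB hM hc)).
by apply: filterS h => t; rewrite /= subr_le0.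
Qed.

Lemma mcvg_unique {FU : ProperFilter U} p q (Phi : T -> 'M[R]_(p, q)) M N :
  mcvg U Phi M -> mcvg U Phi N -> M = N.
Proof. by move=> hM hN; apply/matrixP => i j; exact: cvg_unique (hM i j) (hN i j). Qed.

(** Bolzano-Weierstrass in the form used throughout: along an ultrafilter
    bounded functions converge, without extracting anything. *)
Lemma ultra_cvg {UU : UltraFilter U} (f : T -> R) (C : R) :
  (\forall t \near U, `|f t| <= C) -> exists l : R, f t @[t --> U] --> l.
Proof.
move=> hC.
have := @segment_compact R (- C) C; rewrite compact_ultra.
move=> /(_ (f @ U) (ultra_fmap f UU)) [|l [_ hl]]; last by exists l.
by apply: filterS hC => t; rewrite /= in_itv /= ler_norml.
Qed.

Lemma mcvg_ultra {UU : UltraFilter U} p q (Phi : T -> 'M[R]_(p, q)) (C : R) :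
  (\forall t \near U, frob (Phi t) <= C) -> exists M, mcvg U Phi M.
Proof.
move=> hC.
have h i j : {l : R | Phi t i j @[t --> U] --> l}.
  apply/cid/(@ultra_cvg _ _ C); apply: filterS hC => t.
  exact/le_trans/normr_le_frob.
by exists (\matrix_(i, j) sval (h i j)) => i j; rewrite mxE; exact: svalP (h i j).
Qed.

End filter.

(** An ultrafilter chooses among finitely many alternatives: points of a meshed
    domain eventually stay in one and the same triangle. *)
Lemma ultra_exists_fin (T : Type) (U : set_system T) {UU : UltraFilter U}
    (I : finType) (P : I -> set T) :
  (\forall t \near U, exists i, P i t) -> exists i, \forall t \near U, P i t.
Proof.
move=> h; apply: contrapT => /forallNP hn.
have : \forall t \near U, forall i, ~ P i t.
  apply: filter_forall => i.
  by have [/hn//|] := in_ultra_setVsetC (P i) UU.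
by move/(filterI h) => /(@filter_ex _ U) [t /= [[i] Pi /(_ i)]].
Qed.

End matrix_limits.

(** * Algebra of a nondegenerate triangle *)

Local Ltac mxring := by apply/matrixP => ? ?; rewrite !mxE; ring.

Lemma ord3W (P : 'I_3 -> Prop) : P 0 -> P 1 -> P 2 -> forall l, P l.
Proof.
move=> P0 P1 P2 [[|[|[|//]]] i].
- by have -> : Ordinal i = 0 by apply: val_inj.
- by have -> : Ordinal i = 1 by apply: val_inj.
- by have -> : Ordinal i = 2 by apply: val_inj.
Qed.

Lemma sum_ord3 (V : nmodType) (F : 'I_3 -> V) : \sum_l F l = F 0 + F 1 + F 2.
Proof.
by rewrite !big_ord_recl big_ord0 addr0 addrA; congr (F _ + F _ + F _); apply: val_inj.
Qed.

Lemma trmx_mul_ip (R : realType) m (u w : 'cV[R]_m) : u^T *m w = (ip u w)%:M.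
Proof. by rewrite -dotE; apply/matrixP => i j; rewrite !ord1 [RHS]mxE eqxx mulr1n. Qed.

Section triangle_algebra.
Variables (R : realType) (m : nat) (v : 'I_3 -> 'cV[R]_m).
Hypothesis v_nondeg : 0 < area v.

Local Notation a := (edge v 2).
Local Notation b := (edge v 0).
Local Notation g := (ip a a * ip b b - ip a b ^+ 2).

Lemma edge0E : edge v 0 = v 1 - v 2.
Proof. by rewrite /edge !add0r. Qed.

Lemma edge1E : edge v 1 = v 2 - v 0.
Proof. by rewrite /edge; congr (v _ - v _); apply: val_inj. Qed.

Lemma edge2E : edge v 2 = v 0 - v 1.
Proof. by rewrite /edge; congr (v _ - v _); apply: val_inj. Qed.

Lemma edge1_sum : edge v 1 = - (a + b).
Proof. rewrite edge0E edge1E edge2E; mxring. Qed.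

Lemma sum_edge : \sum_l edge v l = 0.
Proof. by rewrite sum_ord3 edge1_sum; mxring. Qed.

Lemma areaE : area v = Num.sqrt g / 2.
Proof. by rewrite /area !dotE !sqr_frob. Qed.

Lemma tri_gram_gt0 : 0 < g.
Proof. by move: v_nondeg; rewrite areaE pmulr_lgt0 ?invr_gt0 // sqrtr_gt0. Qed.

Lemma double_area_sqr : (2 * area v) ^+ 2 = g.
Proof.
have -> : 2 * area v = Num.sqrt g by rewrite areaE; field.
by rewrite sqr_sqrtr // ltW // tri_gram_gt0.
Qed.

(** The triple product behind the cross products: with bivectors as matrices,
    b_l is explicit in terms of two edges, and every identity below is a
    polynomial identity in their Gram matrix. *)
Lemma bary_gradE l :
  bary_grad v l = g^-1 *: (ip b (edge v l) *: a - ip a (edge v l) *: b).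
Proof.
rewrite /bary_grad /unit_normal /ext -scalemxAl scalerA -invfM -expr2.
rewrite double_area_sqr mulmxBl -!mulmxA.
by rewrite !trmx_mul_ip !mul_mx_scalar.
Qed.

Lemma sum_bary_grad : \sum_l bary_grad v l = 0.
Proof.
rewrite (eq_bigr _ (fun l _ => bary_gradE l)) -scaler_sumr.
rewrite big_split sumrN -!scaler_suml /= -!ip_sumr sum_edge !ip0r.
by rewrite !scale0r subrr scaler0.
Qed.

Lemma sqr_frob_bary_grad l : frob (bary_grad v l) ^+ 2 = frob (edge v l) ^+ 2 / g.
Proof.
have g0 := lt0r_neq0 tri_gram_gt0.
rewrite !sqr_frob bary_gradE.
move: l; apply: ord3W; rewrite ?edge1_sum; move: g0; move: a b => p q g0;
by rewrite ?(ipZl, ipZr, ipNr, ipNl, ipDl, ipDr) ?(ipC q p); field.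
Qed.

Lemma frob_bary_grad l : frob (bary_grad v l) = frob (edge v l) / (2 * area v).
Proof.
have A0 : 0 < 2 * area v by rewrite mulr_gt0.
apply/eqP; rewrite -(eqrXn2 (n := 2)) // ?divr_ge0 ?frob_ge0 ?(ltW A0) //.
by rewrite sqr_frob_bary_grad expr_div_n double_area_sqr.
Qed.

Lemma ip_bary_grad l k :
  ip (bary_grad v l) (v k - v 0) = (l == k)%:R - (l == 0)%:R.
Proof.
have g0 := lt0r_neq0 tri_gram_gt0.
have h0 : v 0 - v 0 = 0 :> 'cV_m by rewrite subrr.
have h1 : v 1 - v 0 = - a by rewrite edge2E; mxring.
have h2 : v 2 - v 0 = - (a + b) by rewrite edge2E edge0E; mxring.
rewrite bary_gradE.
move: l; apply: ord3W; move: k; apply: ord3W;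
  rewrite ?h0 ?h1 ?h2 ?edge1_sum {h0 h1 h2}; move: g0; move: a b => p q g0;
by rewrite ?(ipZl, ipZr, ipNr, ipNl, ipDl, ipDr) ?ip0r ?(ipC q p) /=; field.
Qed.

(** The linear interpolant of the identity has this matrix as its gradient; it
    is the orthogonal projector onto the direction of the plane of v. *)
Definition tri_proj : 'M[R]_m := \sum_l v l *m (bary_grad v l)^T.

(** The base point w is free because the b_l add up to 0; choosing it well is
    what makes Taylor expansions usable below. *)
Lemma sum_mul_bary_grad p (J : 'M[R]_(p, m)) (w : 'cV[R]_m) :
  \sum_l (J *m (v l - w)) *m (bary_grad v l)^T = J *m tri_proj.
Proof.
under eq_bigr do rewrite mulmxBr mulmxBl -!mulmxA.
rewrite big_split sumrN /= -!mulmx_sumr -linear_sum sum_bary_grad.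
by rewrite /= trmx0 !mulmx0 subr0.
Qed.

Lemma tri_projE :
  tri_proj = g^-1 *: (ip b b *: (a *m a^T) - ip a b *: (a *m b^T + b *m a^T)
                      + ip a a *: (b *m b^T)).
Proof.
have := @sum_mul_bary_grad _ 1%:M (v 1); rewrite mul1mx => <-.
rewrite sum_ord3 !mul1mx subrr mul0mx addr0.
have -> : v 0 - v 1 = a by rewrite edge2E.
have -> : v 2 - v 1 = - b by rewrite edge0E; mxring.
rewrite !bary_gradE; move: a b => p q; rewrite (ipC q p).
by apply/matrixP => i j; rewrite !(mxE, big_ord1); ring.
Qed.

Lemma tr_tri_proj : tri_proj^T = tri_proj.
Proof.
rewrite tri_projE; move: a b => p q.
by apply/matrixP => i j; rewrite !(mxE, big_ord1); ring.
Qed.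

Lemma tri_proj_edge k : tri_proj *m (v k - v 0) = v k - v 0.
Proof.
rewrite /tri_proj mulmx_suml; under eq_bigr do
  rewrite -mulmxA trmx_mul_ip ip_bary_grad mul_mx_scalar scalerBl.
rewrite big_split sumrN /=; congr (_ - _).
  rewrite (bigD1 k) //= ?eqxx ?scale1r big1 ?addr0 // => l /negPf ->.
  by rewrite scale0r.
rewrite (bigD1 0) //= ?eqxx ?scale1r big1 ?addr0 // => l /negPf ->.
by rewrite scale0r.
Qed.

Lemma tri_proj_idem : tri_proj *m tri_proj = tri_proj.
Proof.
have := @sum_mul_bary_grad _ 1%:M (v 0); rewrite mul1mx => E.
rewrite -{2}E mulmx_sumr -[RHS]E; apply: eq_bigr => l _.
by rewrite mul1mx mulmxA tri_proj_edge.
Qed.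

Lemma mxtrace_tri_proj : \tr tri_proj = 2.
Proof.
have g0 := lt0r_neq0 tri_gram_gt0.
rewrite tri_projE mxtraceZ !mxtraceD mxtraceZ.
have -> : \tr (- (ip a b *: (a *m b^T + b *m a^T))) = - (ip a b * (ip a b + ip a b)).
  rewrite raddfN /= mxtraceZ mxtraceD (mxtrace_mulC a) (mxtrace_mulC b).
  by rewrite -/(ip b a) -/(ip a b) (ipC b a).
rewrite mxtraceZ (mxtrace_mulC a) (mxtrace_mulC b) -/(ip a a) -/(ip b b).
by field.
Qed.

(** The barycentric coordinates; the choice of v 0 as base point costs a
    Kronecker delta but makes their gradients visible. *)
Definition bary (l : 'I_3) (p : 'cV[R]_m) : R :=
  (l == 0)%:R + ip (bary_grad v l) (p - v 0).

Lemma sum_bary p : \sum_l bary l p = 1.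
Proof.
rewrite big_split /= (bigD1 0) //= big1 => [|l /negPf -> //].
rewrite ?eqxx addr0; under eq_bigr do rewrite ipC.
by rewrite -ip_sumr sum_bary_grad ip0r addr0.
Qed.

Lemma bary_comb (c : 'I_3 -> R) l :
  \sum_k c k = 1 -> bary l (\sum_k c k *: v k) = c l.
Proof.
move=> c1; rewrite /bary.
have -> : \sum_k c k *: v k - v 0 = \sum_k c k *: (v k - v 0).
  under [RHS]eq_bigr do rewrite scalerBr.
  by rewrite big_split sumrN -scaler_suml c1 scale1r.
rewrite ip_sumr; under eq_bigr do rewrite ipZr ip_bary_grad mulrBr.
rewrite big_split sumrN -mulr_suml c1 mul1r /= addrCA subrr addr0.
rewrite (bigD1 l) //= ?eqxx mulr1 big1 ?addr0 // => k.
by rewrite eq_sym => /negPf ->; rewrite mulr0.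
Qed.

End triangle_algebra.

Section plane_triangle.
Variables (R : realType) (v : 'I_3 -> 'cV[R]_2).
Hypothesis v_nondeg : 0 < area v.

(** An orthogonal projector of trace 2 in the plane is the identity, since
    |1 - P|^2 = tr (1 - P) = 0. *)
Lemma tri_proj1 : tri_proj v = 1%:M.
Proof.
apply/eqP; rewrite eq_sym -subr_eq0; apply/eqP/frob_eq0; rewrite frobE.
rewrite /ip.
have -> : (1%:M - tri_proj v)^T = 1%:M - tri_proj v.
  by rewrite linearB /= trmx1 tr_tri_proj.
rewrite mulmxBl mul1mx mulmxBr mulmx1.
rewrite tri_proj_idem // subrr subr0 raddfB /= mxtrace1 mxtrace_tri_proj //.
by rewrite subrr sqrtr0.
Qed.

Lemma baryK p : \sum_l bary v l p *: v l = p.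
Proof.
have := sum_mul_bary_grad v_nondeg 1%:M 0.
rewrite mul1mx tri_proj1 => /(congr1 (mulmx^~ (p - v 0))).
rewrite mul1mx mulmx_suml.
under eq_bigr do rewrite subr0 mul1mx -mulmxA trmx_mul_ip mul_mx_scalar.
move=> E; rewrite /bary; under eq_bigr do rewrite scalerDl.
rewrite big_split /= E (bigD1 0) //= big1 => [|l /negPf ->]; last by rewrite scale0r.
by rewrite ?eqxx scale1r addr0 addrC subrK.
Qed.

Lemma hullP p : hull v p <-> forall l, 0 <= bary v l p.
Proof.
split => [[c [c0 c1 ->]] l|h]; first by rewrite bary_comb.
by exists (fun l => bary v l p); split => //; rewrite ?sum_bary ?baryK.
Qed.

End plane_triangle.

(** * Shape regularity *)

Section shape.
Variables (R : realType) (m : nat) (v : 'I_3 -> 'cV[R]_m).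
Hypothesis v_nondeg : 0 < area v.

Local Notation len l := (frob (edge v l)).

Lemma ord3_shift (l : 'I_3) :
  (l + 2 + 1 = l) * (l + 2 + 2 = l + 1) * (l + 1 + 1 = l + 2) * (l + 1 + 2 = l).
Proof. by move: l; apply: ord3W; do !split; apply: val_inj. Qed.

Lemma sum_edge_shift l : edge v l = - (edge v (l + 1) + edge v (l + 2)).
Proof.
rewrite /edge !ord3_shift.
by apply/matrixP => i j; rewrite !mxE; ring.
Qed.

Lemma tri_gram_shift l :
  ip (edge v (l + 1)) (edge v (l + 1)) * ip (edge v (l + 2)) (edge v (l + 2))
  - ip (edge v (l + 1)) (edge v (l + 2)) ^+ 2 = (2 * area v) ^+ 2.
Proof.
rewrite double_area_sqr //.
have h0 : edge v 1 = - (edge v 2 + edge v 0) by rewrite edge1_sum.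
move: l; apply: ord3W; rewrite ?add0r.
- rewrite h0; move: (edge v 0) (edge v 2) => p q.
  by rewrite !(ipNl, ipNr, ipDl, ipDr) (ipC p q); ring.
- have -> : 1 + 1 = 2 :> 'I_3 by apply: val_inj.
  by have -> : 1 + 2 = 0 :> 'I_3 by apply: val_inj.
- have -> : 2 + 1 = 0 :> 'I_3 by apply: val_inj.
  have -> : 2 + 2 = 1 :> 'I_3 by apply: val_inj.
  rewrite h0; move: (edge v 0) (edge v 2) => p q.
  by rewrite !(ipNl, ipNr, ipDl, ipDr) (ipC p q); ring.
Qed.

Lemma ord3_shiftP (l k : 'I_3) : [\/ k = l, k = l + 1 | k = l + 2].
Proof.
have : [|| k == l, k == l + 1 | k == l + 2].
  by move: l; apply: ord3W; move: k; apply: ord3W.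
by case/or3P => /eqP ->; [constructor 1 | constructor 2 | constructor 3].
Qed.

Lemma area2_gt0 : 0 < 2 * area v.
Proof. by rewrite mulr_gt0. Qed.

Lemma len_gt0 l : 0 < len l.
Proof.
rewrite lt_def frob_ge0 andbT; apply/eqP => /frob_eq0 e0.
have := tri_gram_shift (l + 2); rewrite !ord3_shift e0 ip0r ip0l.
rewrite mul0r expr0n subrr => h.
by have := exprn_gt0 2 area2_gt0; rewrite -h ltxx.
Qed.

(** The law of cosines and the area formula, with c in place of the cosine so
    that angles are compared through algebra only. *)
Lemma angle_spec l : exists c, [/\ angle v l = acos c, -1 <= c <= 1,
  2 * len (l + 1) * len (l + 2) * c = len (l + 1) ^+ 2 + len (l + 2) ^+ 2 - len l ^+ 2
  & (len (l + 1) * len (l + 2)) ^+ 2 * (1 - c ^+ 2) = (2 * area v) ^+ 2].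
Proof.
set p := edge v (l + 1); set q := edge v (l + 2).
have p0 : 0 < frob p by exact: len_gt0.
have q0 : 0 < frob q by exact: len_gt0.
have Ep : v (l + 2) - v l = p by rewrite /p /edge !ord3_shift.
have Eq : v (l + 1) - v l = - q by rewrite /q /edge !ord3_shift opprB.
have G := tri_gram_shift l; rewrite -/p -/q in G.
have El : len l = frob (p + q) by rewrite sum_edge_shift frobN.
rewrite /angle Ep Eq El; clearbody p q; clear Ep Eq El.
pose c := - ip p q / (frob p * frob q).
have G' : (frob p * frob q) ^+ 2 * (1 - c ^+ 2) = (2 * area v) ^+ 2.
  rewrite -G -!sqr_frob /c; field.
  by rewrite !gt_eqF.
exists c; split => //.
- by rewrite dotE ipNl frobN (ipC q) (mulrC (frob q)).
- have : 0 < 1 - c ^+ 2.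
    rewrite -(pmulr_rgt0 _ (exprn_gt0 2 (mulr_gt0 p0 q0))) G'.
    by rewrite exprn_gt0 // area2_gt0.
  move=> h; rewrite -ler_norml -(@expr_le1 _ 2) //.
  by rewrite real_normK ?num_real //; lra.
- rewrite !sqr_frob ipDl !ipDr (ipC q p).
  by rewrite /c; field; rewrite !gt_eqF.
Qed.

Lemma sin_angle l : sin (angle v l) * (len (l + 1) * len (l + 2)) = 2 * area v.
Proof.
have [c [-> c1 _ G]] := angle_spec l.
rewrite sin_acos // -[RHS]ger0_norm ?(ltW area2_gt0) // -sqrtr_sqr -G.
have h : 0 <= len (l + 1) * len (l + 2) by rewrite mulr_ge0.
by rewrite sqrtrM ?sqr_ge0 // sqrtr_sqr (ger0_norm h) mulrC.
Qed.

Lemma min_angleP : exists l0, min_angle v = angle v l0 /\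
  forall l, angle v l0 <= angle v l.
Proof.
have hpi l : angle v l <= pi.
  by have [c [-> c1 _ _]] := angle_spec l; exact: acos_lepi.
exists [arg min_(l < 0%R) angle v l]%O; split.
  by rewrite /min_angle (bigmin_eq_arg _ 0).
by case: arg_minP => // l0 _ h l; exact: h.
Qed.

(** The smallest angle faces the shortest side.  Here cp and cq are the cosines
    of the angles facing p and q; if q < p, their comparison forces p + q <= r,
    against Heron's formula (h3). *)
Lemma side_le_of_cos p q r cp cq : 0 < p -> 0 < q -> 0 < r -> cp ^+ 2 < 1 ->
  cq <= cp ->
  2 * q * r * cp = q ^+ 2 + r ^+ 2 - p ^+ 2 ->
  2 * p * r * cq = p ^+ 2 + r ^+ 2 - q ^+ 2 -> p <= q :> R.
Proof.
move=> p0 q0 r0 c1 le_c Ep Eq; rewrite leNgt; apply/negP => qp.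
have h1 : (p - q) * ((p + q) ^+ 2 - r ^+ 2) <= 0.
  have -> : (p - q) * ((p + q) ^+ 2 - r ^+ 2) =
            q * (p ^+ 2 + r ^+ 2 - q ^+ 2) - p * (q ^+ 2 + r ^+ 2 - p ^+ 2).
    ring.
  rewrite -Ep -Eq.
  have -> : q * (2 * p * r * cq) - p * (2 * q * r * cp) = 2 * p * q * r * (cq - cp).
    ring.
  by rewrite mulr_ge0_le0 ?subr_le0 // !mulr_ge0 // ltW.
have h2 : (p + q) ^+ 2 <= r ^+ 2.
  by rewrite -subr_le0; rewrite pmulr_rle0 // subr_gt0 in h1.
have h3 : 0 < ((q + r) ^+ 2 - p ^+ 2) * (p ^+ 2 - (q - r) ^+ 2).
  have -> : ((q + r) ^+ 2 - p ^+ 2) * (p ^+ 2 - (q - r) ^+ 2) =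
     4 * q ^+ 2 * r ^+ 2 - (q ^+ 2 + r ^+ 2 - p ^+ 2) ^+ 2 by ring.
  rewrite -Ep.
  have -> : 4 * q ^+ 2 * r ^+ 2 - (2 * q * r * cp) ^+ 2 =
    4 * (q ^+ 2 * r ^+ 2) * (1 - cp ^+ 2) by ring.
  by rewrite mulr_gt0 ?subr_gt0 // !mulr_gt0 // exprn_gt0.
have h4 : p + q <= r.
  by rewrite -ler_sqr ?nnegrE // ?addr_ge0 ?(ltW p0) ?(ltW q0) ?(ltW r0).
have h5 : p ^+ 2 <= (r - q) ^+ 2.
  by rewrite ler_sqr ?nnegrE; lra.
have h6 : 0 <= (q + r) ^+ 2 - p ^+ 2.
  by rewrite subr_ge0 ler_sqr ?nnegrE; lra.
suff : ((q + r) ^+ 2 - p ^+ 2) * (p ^+ 2 - (q - r) ^+ 2) <= 0 by rewrite leNgt h3.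
by rewrite mulr_ge0_le0 // subr_le0 (_ : q - r = - (r - q)) ?sqrrN // opprB.
Qed.

Lemma le_len_min_angle l0 l :
  (forall k, angle v l0 <= angle v k) -> len l0 <= len l.
Proof.
move=> hmin.
have [c0 [E0 c01 L0 G0]] := angle_spec l0.
have c0lt : c0 ^+ 2 < 1.
  have l12 := mulr_gt0 (len_gt0 (l0 + 1)) (len_gt0 (l0 + 2)).
  rewrite -subr_gt0 -(pmulr_rgt0 _ (exprn_gt0 2 l12)).
  by rewrite G0 exprn_gt0 // area2_gt0.
have cle k c : angle v k = acos c -> -1 <= c <= 1 -> c <= c0.
  move=> Ek ck; have := hmin k; rewrite E0 Ek leNgt => h; rewrite leNgt.
  apply: contra h => c0c; rewrite -ltr_cos ?acosK ?in_itv //=;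
    by rewrite acos_ge0 ?acos_lepi.
have [c1 [E1 c11 L1 _]] := angle_spec (l0 + 1).
have [c2 [E2 c21 L2 _]] := angle_spec (l0 + 2).
rewrite !ord3_shift in L1 L2.
have [->//|->|->] := ord3_shiftP l0 l.
- apply: (@side_le_of_cos _ _ (len (l0 + 2)) c0 c1) => //; rewrite ?len_gt0 //.
  + exact: cle E1 c11.
  + by lra.
- apply: (@side_le_of_cos _ _ (len (l0 + 1)) c0 c2) => //; rewrite ?len_gt0 //.
  + exact: cle E2 c21.
  + by lra.
Qed.

Lemma len_le_diam l : len l <= diam v.
Proof. exact: le_bigmax_cond. Qed.

Lemma diam_len : exists l, diam v = len l.
Proof.
rewrite /diam (bigmax_eq_arg _ 0) //.
by eexists.
Qed.

Lemma sin_min_angle_gt0 : 0 < sin (min_angle v).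
Proof.
have [l0 [-> _]] := min_angleP.
have := area2_gt0; rewrite -(sin_angle l0) pmulr_lgt0 //.
by rewrite mulr_gt0 ?len_gt0.
Qed.

(** The side facing the smallest angle is the shortest, so by the triangle
    inequality the diameter is at most twice each of the other two. *)
Lemma sqr_diam_sin_le : diam v ^+ 2 * sin (min_angle v) <= 2 * (2 * area v).
Proof.
have sgt0 := sin_min_angle_gt0.
have [l0 [E hmin]] := min_angleP; rewrite E in sgt0 *.
rewrite -(sin_angle l0) mulrCA mulrC ler_pM2l //.
have h1 := le_len_min_angle (l0 + 1) hmin; have h2 := le_len_min_angle (l0 + 2) hmin.
have p0 := len_gt0 l0.
have t1 : len (l0 + 1) <= len l0 + len (l0 + 2).
  rewrite (sum_edge_shift (l0 + 1)) frobN !ord3_shift addrC.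
  exact: frobD.
have t2 : len (l0 + 2) <= len l0 + len (l0 + 1).
  by rewrite (sum_edge_shift (l0 + 2)) frobN !ord3_shift; exact: frobD.
have [l ->] := diam_len.
have [->|->|->] := ord3_shiftP l0 l; nra.
Qed.

(** The norm of bary_grad v l is the inverse of a height, and the area is half
    the product of the sides enclosing the smallest angle and its sine; these
    are the two longer sides, hence at least half the diameter. *)
Lemma frob_bary_grad_le l :
  frob (bary_grad v l) * diam v ^+ 2 <= 2 * (diam v / sin (min_angle v)).
Proof.
have s0 := sin_min_angle_gt0; have A0 := area2_gt0.
have d0 : 0 < diam v by rewrite (lt_le_trans (len_gt0 l)) // len_le_diam.
rewrite frob_bary_grad //.
have h : diam v ^+ 2 / (2 * area v) <= 2 / sin (min_angle v).
  by rewrite ler_pdivrMr // mulrAC ler_pdivlMr // sqr_diam_sin_le.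
apply: le_trans (_ : diam v * (diam v ^+ 2 / (2 * area v)) <= _); last first.
  by have := ler_wpM2l (ltW d0) h; lra.
rewrite mulrAC -mulrA ler_wpM2r ?len_le_diam //.
by rewrite divr_ge0 ?sqr_ge0 // ltW.
Qed.

End shape.

(** * Mean value inequality *)

Section mean_value.
Variable R : realType.

(** Only one-sided information is asked for at 0 and 1, since segments may end
    on the boundary of the domain. *)
Lemma mean_value_unit (phi dphi : R -> R) :
  (forall s0, 0 <= s0 <= 1 -> forall eps, 0 < eps -> exists2 d, 0 < d &
     forall s, 0 <= s <= 1 -> `|s - s0| < d ->
       `|phi s - phi s0 - (s - s0) * dphi s0| <= eps * `|s - s0|) ->
  exists2 c, 0 <= c <= 1 & phi 1 - phi 0 = dphi c.
Proof.
move=> H.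
have [|||c c01 E] := @MVT_segment R phi dphi 0 1.
- exact: ler01.
- move=> s0; rewrite in_itv /= => /andP[s00 s01].
  have L : (fun h => h^-1 *: ((phi \o shift s0) (h *: (1 : R)) - phi s0)) @ 0^'
      --> dphi s0.
    apply/cvgrPdist_le => eps eps0.
    have [|d d0 Hd] := H s0 _ eps eps0; first by rewrite (ltW s00) (ltW s01).
    near=> h.
    have h0 : h != 0 by near: h; exact: nbhs_dnbhs_neq.
    have hn : 0 < `|h| by rewrite normr_gt0.
    have e1 : shift s0 (h *: (1 : R)) = h + s0.
      by rewrite /shift /= -[h *: 1]/(h * 1) mulr1.
    rewrite /comp e1 distrC.
    have -> : h^-1 *: (phi (h + s0) - phi s0) - dphi s0 =
        h^-1 * (phi (h + s0) - phi s0 - (h + s0 - s0) * dphi s0).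
      by rewrite -[_ *: _]/(_ * _); field.
    rewrite normrM normfV ler_pdivrMl //.
    rewrite [leRHS]mulrC.
    have -> : eps * `|h| = eps * `|h + s0 - s0| by rewrite addrK.
    have hd : `|h| < Num.min d (Num.min s0 (1 - s0)).
      near: h; apply: dnbhs0_lt.
      by rewrite !lt_min d0 s00 subr_gt0 s01.
    move: hd; rewrite !lt_min => /and3P[hd hs hs1].
    apply: Hd; last by rewrite addrK.
    move: hs hs1; rewrite !ltr_norml => /andP[? ?] /andP[? ?].
    by apply/andP; split; lra.
  by apply: DeriveDef; [exact: cvgP L | exact: cvg_lim L].
- apply/subspace_continuousP => s0; rewrite /= in_itv /= => s01.
  apply/cvgrPdist_le => eps eps0.
  have [|d d0 Hd] := H s0 s01 1; first exact: ltr01.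
  have c0 : 0 < 1 + `|dphi s0| by rewrite ltr_pwDl.
  have e0 : 0 < Num.min d (eps / (1 + `|dphi s0|)) by rewrite lt_min d0 divr_gt0.
  have hn : \forall s \near s0, `|s - s0| < Num.min d (eps / (1 + `|dphi s0|)).
    near=> s; rewrite distrC; near: s.
    exact: (@cvgr_dist_lt _ _ _ (nbhs s0) _ id).
  rewrite /prop_near1 /within /=; apply: filterS hn => s.
  rewrite lt_min => /andP[h1 h2] sin.
  have s01' : 0 <= s <= 1 by move: sin; rewrite in_itv.
  have := Hd s s01' h1.
  rewrite mul1r => h3.
  rewrite distrC.
  have -> : phi s - phi s0 =
    phi s - phi s0 - (s - s0) * dphi s0 + (s - s0) * dphi s0 by ring.
  apply: le_trans (ler_normD _ _) _; rewrite normrM.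
  have h4 : `|s - s0| * (1 + `|dphi s0|) <= eps by rewrite -ler_pdivlMr // ltW.
  lra.
- by exists c; [rewrite in_itv in c01|rewrite E subr0 mulr1].
Unshelve. all: by end_near. Qed.

Lemma near_frob n (w : 'cV[R]_n) d : 0 < d -> \forall w' \near w, frob (w' - w) < d.
Proof.
move=> d0.
have : mcvg (nbhs w) id w by move=> i j; exact: coord_continuous.
move/mcvg_frob_dist/cvgrPdist_lt => /(_ d d0); apply: filterS => w'.
by rewrite sub0r normrN ger0_norm.
Qed.

Lemma nbhs_frob n (w : 'cV[R]_n) (A : set 'cV[R]_n) :
  nbhs w A -> exists2 d, 0 < d & forall w', frob (w' - w) < d -> A w'.
Proof.
case/nbhs_ballP => d d0 hd; exists d => // w' h; apply: hd.
split => // i j; rewrite /ball /= distrC; apply: le_lt_trans h.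
by have := normr_le_frob (w' - w) i j; rewrite !mxE.
Qed.

(** The scalar mean value theorem is applied to the component along the error
    vector e itself, so no constant depending on the dimension appears. *)
Lemma mean_value_ineq p n (D : set 'cV[R]_p) (u : 'cV[R]_p -> 'cV[R]_n)
    (J : 'cV[R]_p -> 'M[R]_(n, p)) (J0 : 'M[R]_(n, p)) (w w' : 'cV[R]_p) (c : R) :
  (forall s, 0 <= s <= 1 -> D (w + s *: (w' - w))) ->
  (forall s, 0 <= s <= 1 ->
     has_jacobian_in D u (w + s *: (w' - w)) (J (w + s *: (w' - w)))) ->
  (forall s, 0 <= s <= 1 ->
     frob ((J (w + s *: (w' - w)) - J0) *m (w' - w)) <= c) ->
  frob (u w' - u w - J0 *m (w' - w)) <= c.
Proof.
set h := w' - w; move=> HD HJ Hc.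
set e := u w' - u w - J0 *m h.
pose pt s := w + s *: h.
pose phi s := ip e (u (pt s) - s *: (J0 *m h)).
pose dphi s := ip e ((J (pt s) - J0) *m h).
have [|s s01 E] := @mean_value_unit phi dphi.
  move=> s0 s01 eps eps0.
  set K := frob e * frob h + 1.
  have K0 : 0 < K by rewrite ltr_wpDl // mulr_ge0.
  have := HJ s0 s01 (eps / K) (divr_gt0 eps0 K0).
  case/nbhs_frob => d d0 Hd.
  have h0 : 0 < frob h + 1 by rewrite ltr_wpDl.
  exists (d / (frob h + 1)); first by rewrite divr_gt0.
  move=> s s01' sd.
  have ptB : pt s - pt s0 = (s - s0) *: h.
    by rewrite /pt opprD addrACA subrr add0r scalerBl.
  have dpt : frob (pt s - pt s0) < d.
    rewrite ptB frobZ; rewrite ltr_pdivlMr // in sd.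
    by apply: le_lt_trans sd; rewrite ler_wpM2l // lerDl.
  have := Hd _ dpt (HD s s01'); rewrite -/(pt s0) ptB => H.
  have -> : phi s - phi s0 - (s - s0) * dphi s0 =
     ip e (u (pt s) - u (pt s0) - J (pt s0) *m ((s - s0) *: h)).
    rewrite /phi /dphi -ipZr -!ipBr; congr (ip e _).
    rewrite -scalemxAr mulmxBl scalerBr scalerBl.
    by apply/matrixP => i j; rewrite !mxE; ring.
  have le1 : `|ip e (u (pt s) - u (pt s0) - J (pt s0) *m ((s - s0) *: h))|
      <= frob e * (eps / K * frob ((s - s0) *: h)).
    exact: le_trans (norm_ip_le _ _) (ler_wpM2l (frob_ge0 _) H).
  apply: le_trans le1 _; rewrite frobZ.
  have -> : frob e * (eps / K * (`|s - s0| * frob h)) =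
     (eps * `|s - s0|) * ((frob e * frob h) / K) by ring.
  rewrite ler_piMr ?mulr_ge0 ?(ltW eps0) //.
  by rewrite ler_pdivrMr // mul1r /K lerDl.
have E' : phi 1 - phi 0 = frob e ^+ 2.
  have hw' : w + h = w' by rewrite /h addrC subrK.
  rewrite sqr_frob /phi -ipBr /pt !scale1r !scale0r addr0 subr0 hw'.
  by congr (ip e _); rewrite /e addrAC.
rewrite E' in E.
have := le_trans (ip_le_frob _ _) (ler_wpM2l (frob_ge0 e) (Hc s s01)).
rewrite -/(pt s) -/(dphi s) -E expr2.
have [-> _|e0] := eqVneq (frob e) 0.
  exact: le_trans (frob_ge0 _) (Hc s s01).
by rewrite ler_pM2l // lt_def e0 frob_ge0.
Qed.

End mean_value.

(** * Domains covered by finitely many triangles *)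

Section hull.
Variables (R : realType) (m : nat).

Lemma hull_convex (v : 'I_3 -> 'cV[R]_m) p q s :
  hull v p -> hull v q -> 0 <= s <= 1 -> hull v (p + s *: (q - p)).
Proof.
move=> [c [c0 c1 ->]] [d [d0 d1 ->]] /andP[s0 s1].
exists (fun l => (1 - s) * c l + s * d l); split.
- by move=> l; rewrite addr_ge0 // mulr_ge0 // subr_ge0.
- by rewrite big_split /= -!mulr_sumr c1 d1; ring.
- under [RHS]eq_bigr do rewrite scalerDl -!scalerA.
  rewrite big_split /= -!scaler_sumr.
  by apply/matrixP => i j; rewrite !mxE; ring.
Qed.

Lemma hull_vertex (v : 'I_3 -> 'cV[R]_m) l : hull v (v l).
Proof.
exists (fun k => (k == l)%:R); split => [k||]; first exact: ler0n.
- by rewrite (bigD1 l) //= eqxx big1 ?addr0 // => k /negPf ->.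
- by rewrite (bigD1 l) //= eqxx scale1r big1 ?addr0 // => k /negPf ->; rewrite scale0r.
Qed.

Lemma hull_dist (v : 'I_3 -> 'cV[R]_m) p w c :
  hull v p -> (forall l, frob (v l - w) <= c) -> frob (p - w) <= c.
Proof.
move=> [d [d0 d1 ->]] h.
have -> : \sum_l d l *: v l - w = \sum_l d l *: (v l - w).
  under [RHS]eq_bigr do rewrite scalerBr.
  by rewrite big_split sumrN -scaler_suml d1 scale1r.
apply: le_trans (frob_sum _ _ _) _; rewrite -[leRHS]mul1r -d1 mulr_suml.
by apply: ler_sum => l _; rewrite frobZ ger0_norm // ler_wpM2l.
Qed.

Lemma hull_bounded (v : 'I_3 -> 'cV[R]_m) p :
  hull v p -> frob p <= \sum_l frob (v l).
Proof.
move=> hp; rewrite -(subr0 p); apply: (hull_dist hp) => l.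
by rewrite subr0 (bigD1 l) //= lerDl sumr_ge0.
Qed.

End hull.

Section hull_plane.
Variables (R : realType) (v : 'I_3 -> 'cV[R]_2).
Hypothesis v_nondeg : 0 < area v.

Lemma bary_dist l p q :
  `|bary v l p - bary v l q| <= frob (bary_grad v l) * frob (p - q).
Proof.
rewrite /bary opprD addrACA subrr add0r -ipBr opprB addrA subrK.
exact: norm_ip_le.
Qed.

Lemma near_bary_gt l w c : c < bary v l w -> \forall w' \near w, c < bary v l w'.
Proof.
move=> h; set K := frob (bary_grad v l) + 1.
have K0 : 0 < K by rewrite ltr_wpDl.
have := near_frob w (divr_gt0 _ K0); move/(_ (bary v l w - c)).
rewrite subr_gt0 => /(_ h); apply: filterS => w'.
rewrite ltr_pdivlMr // => h1; have := bary_dist l w w'.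
rewrite frobBC => h2.
have : `|bary v l w - bary v l w'| < bary v l w - c.
  apply: le_lt_trans h2 _; apply: le_lt_trans h1.
  by rewrite mulrC ler_wpM2l // lerDl.
by rewrite ltr_norml => /andP[? ?]; lra.
Qed.

Lemma near_bary_lt l w c : bary v l w < c -> \forall w' \near w, bary v l w' < c.
Proof.
move=> h; set K := frob (bary_grad v l) + 1.
have K0 : 0 < K by rewrite ltr_wpDl.
have := near_frob w (divr_gt0 _ K0); move/(_ (c - bary v l w)).
rewrite subr_gt0 => /(_ h); apply: filterS => w'.
rewrite ltr_pdivlMr // => h1; have := bary_dist l w' w.
move=> h2.
have : `|bary v l w' - bary v l w| < c - bary v l w.
  apply: le_lt_trans h2 _; apply: le_lt_trans h1.
  by rewrite mulrC ler_wpM2l // lerDl.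
by rewrite ltr_norml => /andP[? ?]; lra.
Qed.

Lemma near_not_hull w : ~ hull v w -> \forall w' \near w, ~ hull v w'.
Proof.
move=> nh; have [l hl] : exists l, bary v l w < 0.
  apply: contrapT => /forallNP h; apply: nh; apply/hullP => // l.
  by rewrite leNgt; apply/negP/h.
apply: filterS (near_bary_lt hl) => w' h /hullP => /(_ v_nondeg l).
by rewrite leNgt h.
Qed.

Lemma bary_gt0_interior w : (forall l, 0 < bary v l w) -> (hull v)° w.
Proof.
move=> h; rewrite /interior /=.
have : \forall w' \near w, forall l, 0 < bary v l w'.
  apply: (@filter_forall _ _ (fun l w' => 0 < bary v l w') (nbhs w) _) => l.
  exact: near_bary_gt.
by apply: filterS => w' h'; apply/hullP => // l; exact: ltW.
Qed.

Lemma eq_mx_on_hull n w (J J' : 'M[R]_(n, 2)) :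
  (forall l, J *m (v l - w) = J' *m (v l - w)) -> J = J'.
Proof.
move=> h; rewrite -(mulmx1 J) -(mulmx1 J') -(tri_proj1 v_nondeg).
rewrite -!(sum_mul_bary_grad v_nondeg _ w).
by apply: eq_bigr => l _; rewrite h.
Qed.

(** The directions from w to the three vertices span the plane, even if w is on
    the boundary of the triangle. *)
Lemma has_jacobian_in_unique n (D : set 'cV[R]_2) (u : 'cV[R]_2 -> 'cV[R]_n) w J J' :
  hull v `<=` D -> hull v w ->
  has_jacobian_in D u w J -> has_jacobian_in D u w J' -> J = J'.
Proof.
move=> hD hw hJ hJ'; apply: (@eq_mx_on_hull _ w) => l.
set h := v l - w.
apply/eqP; rewrite -subr_eq0 -mulmxBl; apply/eqP/frob_eq0/eqP.
rewrite eq_le frob_ge0 andbT.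
apply/ler_addgt0Pl => e e0; rewrite addr0.
have K0 : 0 < 2 * (frob h + 1) by rewrite mulr_gt0 // ltr_wpDl.
have e'0 : 0 < e / (2 * (frob h + 1)) by rewrite divr_gt0.
have [d d0 hd] := nbhs_frob (filterI (hJ _ e'0) (hJ' _ e'0)).
have h0 : 0 < frob h + 1 by rewrite ltr_wpDl.
pose s := Num.min 1 (d / (2 * (frob h + 1))).
have s0 : 0 < s by rewrite lt_min ltr01 divr_gt0.
have s01 : 0 <= s <= 1 by rewrite (ltW s0) ge_min lexx.
have ws : hull v (w + s *: h) by apply: hull_convex => //; exact: hull_vertex.
have sd : frob (w + s *: h - w) < d.
  rewrite addrAC subrr add0r frobZ (gtr0_norm s0).
  have : s <= d / (2 * (frob h + 1)) by rewrite ge_min lexx orbT.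
  rewrite ler_pdivlMr // => sle; apply: lt_le_trans sle.
  by rewrite ltr_pM2l //; have := frob_ge0 h; lra.
have [/= H H'] := hd _ sd (hD _ ws).
have hw' : w + s *: h - w = s *: h by rewrite addrAC subrr add0r.
rewrite hw' in H H'.
have : frob ((J - J') *m (s *: h)) <= e / (2 * (frob h + 1)) * frob (s *: h) * 2.
  have -> : (J - J') *m (s *: h) = (u (w + s *: h) - u w - J' *m (s *: h))
      - (u (w + s *: h) - u w - J *m (s *: h)).
    rewrite mulmxBl; move: (u _ - u w) (J *m _) (J' *m _) => a b c.
    by apply/matrixP => i j; rewrite !mxE; ring.
  by apply: le_trans (frobB _ _) _; lra.
rewrite -scalemxAr !frobZ (gtr0_norm s0).
have -> : e / (2 * (frob h + 1)) * (s * frob h) * 2 = s * (e * (frob h / (frob h + 1))).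
  by field; rewrite gt_eqF.
rewrite ler_pM2l // => /le_trans; apply.
by rewrite ler_piMr ?(ltW e0) // ler_pdivrMr // mul1r lerDl.
Qed.

End hull_plane.

(** Omega need not be convex nor even connected; estimates are stated along
    segments that it contains, and every mesh triangle provides such segments. *)
Definition segment_in (R : realType) (D : set 'cV[R]_2) (w w' : 'cV[R]_2) :=
  forall s : R, 0 <= s <= 1 -> D (w + s *: (w' - w)).

Lemma segment_in_l (R : realType) (D : set 'cV[R]_2) w w' : segment_in D w w' -> D w.
Proof. by move/(_ 0); rewrite scale0r addr0 lexx ler01 => /(_ isT). Qed.

Lemma segment_in_r (R : realType) (D : set 'cV[R]_2) w w' : segment_in D w w' -> D w'.
Proof. by move/(_ 1); rewrite scale1r addrC subrK lexx ler01 => /(_ isT). Qed.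

Lemma segment_in_sub (R : realType) (D : set 'cV[R]_2) w w' (s : R) :
  0 <= s <= 1 -> segment_in D w w' -> segment_in D w (w + s *: (w' - w)).
Proof.
move=> /andP[s0 s1] h t /andP[t0 t1].
rewrite [w + _ - w]addrAC subrr add0r scalerA; apply: h.
by rewrite mulr_ge0 //= mulr_ile1.
Qed.

Section limits_in_domain.
Variable R : realType.

Lemma mcvg_nbhs (T : Type) (U : set_system T) {FU : Filter U} n
    (z : T -> 'cV[R]_n) w (A : set 'cV[R]_n) :
  mcvg U z w -> nbhs w A -> \forall t \near U, A (z t).
Proof.
move=> /mcvg_frob_dist /cvgrPdist_lt hz /nbhs_frob [d d0 hd].
apply: filterS (hz d d0) => t; rewrite sub0r normrN ger0_norm //.
exact: hd.
Qed.

(** Differentiability relative to D gives continuity along limits inside D. *)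
Lemma mcvg_diff (T : Type) (U : set_system T) {FU : Filter U} p n
    (D : set 'cV[R]_p) (u : 'cV[R]_p -> 'cV[R]_n) J (z : T -> 'cV[R]_p) w :
  has_jacobian_in D u w J -> (\forall t \near U, D (z t)) -> mcvg U z w ->
  mcvg U (fun t => u (z t)) (u w).
Proof.
move=> hJ hD hz; apply: mcvg_frob0.
have h1 := @mcvg_nbhs _ U FU _ _ _ _ hz (hJ 1 ltr01).
have h2 : (1 + frob J) * frob (z t - w) @[t --> U] --> 0.
  rewrite -[X in _ --> X](mulr0 (1 + frob J)).
  by apply: cvgM (mcvg_frob_dist hz); exact: cvg_cst.
have h3 : \forall t \near U, 0 <= frob (u (z t) - u w) <= (1 + frob J) * frob (z t - w).
  apply: filterS2 h1 hD => t /= ht Dt.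
  rewrite frob_ge0 /=.
  have h : frob (u (z t) - u w - J *m (z t - w)) <= 1 * frob (z t - w) by exact: ht.
  rewrite -[u _ - u w](subrK (J *m (z t - w))).
  by apply: le_trans (frobD _ _) _; rewrite mulrDl lerD // frobM.
exact: (squeeze_cvgr h3 (cvg_cst 0) h2).
Qed.

End limits_in_domain.

Section mesh_domain.
Variables (R : realType) (m : nat) (Omega : set 'cV[R]_2) (x : 'cV[R]_2 -> 'cV[R]_m).
Variable T : mesh Omega x.

Lemma mesh_nondeg (t : 'I_(mesh_card T)) : 0 < area (mesh_tri t).
Proof. by case: T t. Qed.

Lemma mesh_cover : \bigcup_t hull (@mesh_tri _ _ _ _ T t) = Omega.
Proof. by case: T. Qed.

Lemma mesh_disjoint (t t' : 'I_(mesh_card T)) : t != t' ->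
  (hull (mesh_tri t))° `&` (hull (mesh_tri t'))° = set0.
Proof. by case: T t t'. Qed.

Lemma mesh_V_nondeg (t : 'I_(mesh_card T)) : 0 < area (mesh_V t).
Proof. by rewrite /mesh_V; case: T t. Qed.

Lemma mesh_hull_sub (t : 'I_(mesh_card T)) : hull (mesh_tri t) `<=` Omega.
Proof. by move=> w hw; have /seteqP[h _] := mesh_cover; apply: h; exists t. Qed.

Lemma mesh_hullP w : Omega w -> exists t : 'I_(mesh_card T), hull (mesh_tri t) w.
Proof. by have /seteqP[_ h] := mesh_cover => /h [t _ hw]; exists t. Qed.

Lemma mesh_segment (t : 'I_(mesh_card T)) w w' :
  hull (mesh_tri t) w -> hull (mesh_tri t) w' -> segment_in Omega w w'.
Proof. by move=> hw hw' s s01; apply: (@mesh_hull_sub t); exact: hull_convex. Qed.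

(** Near w only triangles through w are met, so a segment from w to a nearby
    point of Omega stays in Omega. *)
Lemma near_segment w :
  \forall w' \near w, Omega w' -> segment_in Omega w w'.
Proof.
have : \forall w' \near w, forall t : 'I_(mesh_card T),
    hull (mesh_tri t) w' -> hull (mesh_tri t) w.
  apply: (@filter_forall _ _
    (fun t w' => hull (mesh_tri t) w' -> hull (mesh_tri t) w) (nbhs w) _) => t.
  have [hw|hw] := pselect (hull (mesh_tri t) w).
    by apply: nearW => w' _.
  by apply: filterS (near_not_hull (mesh_nondeg t) hw) => w' h /h.
apply: filterS => w' h /mesh_hullP [t hw'].
exact: mesh_segment (h t hw') hw'.
Qed.

Lemma mesh_jacobian_unique n (u : 'cV[R]_2 -> 'cV[R]_n) w J :
  Omega w -> has_jacobian_in Omega u w J -> jacobian_in Omega u w = J.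
Proof.
move=> /mesh_hullP[t hw] hJ.
apply: (has_jacobian_in_unique (mesh_nondeg t) (@mesh_hull_sub t) hw _ hJ).
exact: (xgetPex 0 (ex_intro _ J hJ)).
Qed.

(** Compactness of Omega in ultrafilter form: some triangle contains almost all
    of the points, and it is closed and bounded. *)
Lemma mesh_ultra (S : Type) (U : set_system S) {UU : UltraFilter U}
    (z : S -> 'cV[R]_2) :
  (\forall t \near U, Omega (z t)) ->
  exists2 w, Omega w & mcvg U z w.
Proof.
move=> hz.
have [t ht] : exists t : 'I_(mesh_card T), \forall i \near U, hull (mesh_tri t) (z i).
  by apply: ultra_exists_fin; apply: filterS hz => i; exact: mesh_hullP.
have [w hw] : exists w, mcvg U z w.
  apply: (@mcvg_ultra _ _ _ _ _ _ _ (\sum_l frob (mesh_tri t l))).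
  by apply: filterS ht => i; exact: hull_bounded.
exists w => //; apply: (@mesh_hull_sub t); apply: contrapT => nh.
have h : \forall i \near U, ~ hull (mesh_tri t) (z i).
  exact: mcvg_nbhs hw (near_not_hull (mesh_nondeg t) nh).
by have [i []] := @filter_ex _ U _ _ (@filterI _ U _ _ _ ht h).
Qed.

Lemma diff_bounded n (u : 'cV[R]_2 -> 'cV[R]_n) :
  differentiable_in Omega u ->
  exists2 B : R, 0 <= B & forall w, Omega w -> frob (u w) <= B.
Proof.
move=> du; apply: contrapT => hn.
have /choice [z hz] : forall k : nat, exists w, Omega w /\ k%:R < frob (u w).
  move=> k; apply: contrapT => /forallNP h; apply: hn; exists k%:R => // w Ow.
  by rewrite leNgt; apply/negP => hk; apply: (h w).
have [U [UU sU]] := ultraFilterLemma eventually_filter.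
have [|w Ow hw] := @mesh_ultra _ U UU z.
  by apply: nearW => k; case: (hz k).
have [J hJ] := du w Ow.
have OU : \forall k \near U, Omega (z k) by apply: nearW => k; case: (hz k).
have hu : frob (u (z k)) @[k --> U] --> frob (u w).
  by apply: mcvg_frob; exact: mcvg_diff hJ OU hw.
have h1 : \forall k \near U, frob (u (z k)) < frob (u w) + 1.
  by apply: (cvgr_lt _ hu); rewrite ltrDl.
have h2 : \forall k \near U, frob (u w) + 1 <= k%:R.
  by apply: sU; exact: nbhs_infty_ger.
have [k [k1 k2]] := @filter_ex _ U _ _ (@filterI _ U _ _ _ h1 h2).
by have [_] := hz k; rewrite ltNge (le_trans (ltW k1) k2).
Qed.

End mesh_domain.

(** * The parameterization *)

Section surface_constants.
Variables (R : realType) (m : nat) (Omega : set 'cV[R]_2) (x : 'cV[R]_2 -> 'cV[R]_m).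
Variable T : mesh Omega x.
Hypothesis x_inj : set_inj Omega x.
Hypothesis x_diff : differentiable_in Omega x.
Hypothesis x_lip : exists L : R, lipschitz_with Omega (jacobian_in Omega x) id L.
Hypothesis x_rank : forall w, Omega w -> \rank (jacobian_in Omega x w) = 2%N.

Local Notation Dx := (jacobian_in Omega x).

Lemma x_jacobian w : Omega w -> has_jacobian_in Omega x w (Dx w).
Proof. by move=> /x_diff [J hJ]; exact: (xgetPex 0 (ex_intro _ J hJ)). Qed.

Lemma x_lip_ge0 : exists2 L : R, 0 <= L &
  forall w w', Omega w -> Omega w' -> frob (Dx w - Dx w') <= L * frob (w - w').
Proof.
have [L hL] := x_lip; exists `|L| => // w w' Ow Ow'.
by apply: le_trans (hL _ _ Ow Ow') _; rewrite ler_wpM2r // ler_norm.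
Qed.

Lemma Dx_mcvg (S : Type) (U : set_system S) {FU : Filter U}
    (z : S -> 'cV[R]_2) w :
  Omega w -> (\forall t \near U, Omega (z t)) -> mcvg U z w ->
  mcvg U (fun t => Dx (z t)) (Dx w).
Proof.
move=> Ow Oz hz; have [L L0 hL] := x_lip_ge0; apply: mcvg_frob0.
have h2 : L * frob (z t - w) @[t --> U] --> 0.
  rewrite -[X in _ --> X](mulr0 L).
  by apply: cvgM (mcvg_frob_dist hz); exact: cvg_cst.
have h3 : \forall t \near U, 0 <= frob (Dx (z t) - Dx w) <= L * frob (z t - w).
  by apply: filterS Oz => t Ot; rewrite frob_ge0 hL.
exact: (squeeze_cvgr h3 (cvg_cst 0) h2).
Qed.

Lemma rank2_inj (A : 'M[R]_(m, 2)) (h : 'cV[R]_2) : \rank A = 2%N -> A *m h = 0 -> h = 0.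
Proof.
move=> rA Ah; have fA : row_free A^T by rewrite /row_free mxrank_tr rA.
apply: (can_inj (@trmxK _ _ _)); apply: (row_free_inj fA).
by rewrite -!trmx_mul Ah mulmx0.
Qed.

(** Unit vectors h_k with Dx h_k tending to 0 would accumulate at a unit vector
    in the kernel of some Dx, which has rank 2. *)
Lemma Dx_bounded_below : exists2 q : R, 0 < q &
  forall w (h : 'cV[R]_2), Omega w -> frob h <= q * frob (Dx w *m h).
Proof.
apply: contrapT => hn.
have /choice [z hz] : forall k : nat, exists z : 'cV[R]_2 * 'cV[R]_2,
    [/\ Omega z.1, frob z.2 = 1 & frob (Dx z.1 *m z.2) <= k.+1%:R^-1].
  move=> k; apply: contrapT => /forallNP H; apply: hn; exists k.+1%:R => // w h Ow.
  rewrite leNgt; apply/negP => hk.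
  have h0 : 0 < frob h by apply: le_lt_trans hk; rewrite mulr_ge0.
  apply: (H (w, (frob h)^-1 *: h)); split => //=.
    by rewrite frobZ gtr0_norm ?invr_gt0 // mulVf // gt_eqF.
  rewrite -scalemxAr frobZ gtr0_norm ?invr_gt0 // ler_pdivrMl //.
  by rewrite ler_pdivlMr // mulrC ltW.
have [U [UU sU]] := ultraFilterLemma eventually_filter.
have OU : \forall k \near U, Omega (z k).1 by apply: nearW => k; case: (hz k).
have [w Ow hw] : exists2 w, Omega w & mcvg U (fun k => (z k).1) w.
  exact: (mesh_ultra T).
have [h hh] : exists h, mcvg U (fun k => (z k).2) h.
  by apply: (@mcvg_ultra _ _ _ _ _ _ _ 1); apply: nearW => k; case: (hz k) => _ ->.
have h1 : frob h = 1.
  have c1 : frob (z k).2 @[k --> U] --> frob h by exact: mcvg_frob.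
  have c2 : frob (z k).2 @[k --> U] --> (1 : R).
    have -> : (fun k => frob (z k).2) = fun=> 1 by apply/funext => k; case: (hz k).
    exact: cvg_cst.
  exact: cvg_unique c1 c2.
have hX : mcvg U (fun k => Dx (z k).1 *m (z k).2) (Dx w *m h).
  by apply: mcvgM => //; exact: Dx_mcvg.
have Xh0 : Dx w *m h = 0.
  apply/frob_eq0/eqP; rewrite eq_le frob_ge0 andbT.
  apply: (mcvg_le hX (c := fun k => k.+1%:R^-1)); last first.
    by apply: nearW => k; case: (hz k).
  by apply: cvg_trans (@cvg_harmonic R); apply: cvg_app.
have h0 := rank2_inj (x_rank Ow) Xh0.
by move: h1; rewrite h0 frob0 => /eqP; rewrite eq_sym oner_eq0.
Qed.

(** Taylor's formula to first order with a quadratic remainder. *)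
Lemma x_taylor : exists2 L : R, 0 <= L & forall w w', segment_in Omega w w' ->
  frob (x w' - x w - Dx w *m (w' - w)) <= L * frob (w' - w) ^+ 2.
Proof.
have [L L0 hL] := x_lip_ge0; exists L => // w w' seg.
apply: (@mean_value_ineq _ _ _ Omega x Dx).
- exact: seg.
- by move=> s s01; apply: x_jacobian; exact: seg.
- move=> s s01; apply: le_trans (frobM _ _) _.
  rewrite expr2 mulrA ler_wpM2r //.
  apply: le_trans (hL _ _ (seg _ s01) (segment_in_l seg)) _.
  rewrite ler_wpM2l // addrAC subrr add0r frobZ.
  by case/andP: s01 => s0 s1; rewrite ger0_norm // ler_piMl.
Qed.

Lemma Omega_bounded : exists2 B : R, 0 <= B & forall w, Omega w -> frob w <= B.
Proof.
apply: (diff_bounded T (u := id)) => w Ow; exists 1%:M => e e0.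
by apply: nearW => w'; rewrite mul1mx subrr frob0 mulr_ge0 // ltW.
Qed.

Lemma Dx_bounded : exists2 B : R, 0 <= B & forall w, Omega w -> frob (Dx w) <= B.
Proof.
have [L L0 hL] := x_lip_ge0; have [B B0 hB] := Omega_bounded.
have [[w0 Ow0]|h] := pselect (Omega !=set0); last first.
  by exists 0 => // w Ow; exfalso; apply: h; exists w.
exists (L * (B + B) + frob (Dx w0)); first by rewrite addr_ge0 // mulr_ge0 // addr_ge0.
move=> w Ow; rewrite -{1}(subrK (Dx w0) (Dx w)); apply: le_trans (frobD _ _) _.
rewrite lerD2r; apply: le_trans (hL _ _ Ow Ow0) _; rewrite ler_wpM2l //.
by apply: le_trans (frobB _ _) _; rewrite lerD // hB.
Qed.

Lemma x_bounded : exists2 B : R, 0 <= B & forall w, Omega w -> frob (x w) <= B.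
Proof. exact: (diff_bounded T x_diff). Qed.

Lemma x_lipschitz : exists2 B : R, 0 <= B & forall w w', segment_in Omega w w' ->
  frob (x w' - x w) <= B * frob (w' - w).
Proof.
have [B B0 hB] := Dx_bounded; exists B => // w w' seg.
rewrite -(subr0 (x w' - x w)) -(mul0mx _ (w' - w)).
apply: (@mean_value_ineq _ _ _ Omega x Dx).
- exact: seg.
- by move=> s s01; apply: x_jacobian; exact: seg.
- move=> s s01; rewrite subr0; apply: le_trans (frobM _ _) _.
  by rewrite ler_wpM2r // hB //; exact: seg.
Qed.

(** Short chords are controlled because Dx is bounded below, long ones because x
    is injective on a compact domain.  Both cases appear in one contradiction:
    a sequence of bad chords tends to a point w = w', so it becomes short. *)
Lemma x_bilipschitz : exists2 c : R, 0 < c & forall w w', segment_in Omega w w' ->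
  frob (w' - w) <= c * frob (x w' - x w).
Proof.
have [q q0 hq] := Dx_bounded_below; have [L L0 hL] := x_taylor.
apply: contrapT => hn.
have /choice [z hz] : forall k : nat, exists z : 'cV[R]_2 * 'cV[R]_2,
    segment_in Omega z.1 z.2 /\
    k.+1%:R * frob (x z.2 - x z.1) < frob (z.2 - z.1).
  move=> k; apply: contrapT => /forallNP H; apply: hn; exists k.+1%:R => // w w' s.
  by rewrite leNgt; apply/negP => hk; apply: (H (w, w')).
have [U [UU sU]] := ultraFilterLemma eventually_filter.
have O1 : \forall k \near U, Omega (z k).1.
  by apply: nearW => k; case: (hz k) => /segment_in_l.
have O2 : \forall k \near U, Omega (z k).2.
  by apply: nearW => k; case: (hz k) => /segment_in_r.
have [w Ow hw] : exists2 w, Omega w & mcvg U (fun k => (z k).1) w.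
  exact: (mesh_ultra T).
have [w' Ow' hw'] : exists2 w, Omega w & mcvg U (fun k => (z k).2) w.
  exact: (mesh_ultra T).
have hx : mcvg U (fun k => x (z k).1) (x w) by exact: mcvg_diff (x_jacobian Ow) O1 hw.
have hx' : mcvg U (fun k => x (z k).2) (x w') by exact: mcvg_diff (x_jacobian Ow') O2 hw'.
have [B B0 hB] := Omega_bounded.
have exx : x w' - x w = 0.
  apply/frob_eq0/eqP; rewrite eq_le frob_ge0 andbT.
  have hd : mcvg U (fun k => x (z k).2 - x (z k).1) (x w' - x w) by exact: mcvgB.
  apply: (mcvg_le hd (c := fun k => (B + B) * k.+1%:R^-1)); last first.
    apply: nearW => k; have [s hk] := hz k.
    rewrite ler_pdivlMr // mulrC; apply: le_trans (ltW hk) _.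
    by apply: le_trans (frobB _ _) _; rewrite lerD // hB //;
      [exact: segment_in_r s | exact: segment_in_l s].
  rewrite -[X in _ --> X](mulr0 (B + B)).
  apply: cvgM; first exact: cvg_cst.
  by apply: cvg_trans (@cvg_harmonic R); apply: cvg_app.
have eww : w' = w.
  by apply: x_inj; rewrite ?inE //; apply/eqP; rewrite -subr_eq0 exx.
have hd : frob ((z k).2 - (z k).1) @[k --> U] --> 0.
  rewrite -[X in _ --> X](@frob0 R 2 1) -(subrr w) -{1}eww.
  by apply: mcvg_frob; exact: mcvgB.
have e0 : 0 < (2 * q * L + 1)^-1.
  by rewrite invr_gt0 ltr_wpDl // !mulr_ge0 // ltW.
have n1 : \forall k \near U, frob ((z k).2 - (z k).1) < (2 * q * L + 1)^-1.
  by apply: (cvgr_lt _ hd).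
have n2 : \forall k \near U, 2 * q <= k%:R.
  by apply: sU; exact: nbhs_infty_ger.
have [k [k1 k2]] := @filter_ex _ U _ _ (@filterI _ U _ _ _ n1 n2).
have [s hk] := hz k.
move: (hq _ ((z k).2 - (z k).1) (segment_in_l s)) (hL _ _ s) hk k1 k2 => /=.
set h := _ - (z k).1; set D := x _ - x _; set Y := Dx _ *m h.
move=> H1 H2 H3 H4 H5.
have h0 : 0 < frob h by apply: le_lt_trans H3; rewrite mulr_ge0.
have H6 : frob Y <= frob D + L * frob h ^+ 2.
  have -> : Y = D - (D - Y) by rewrite opprB addrC subrK.
  by apply: le_trans (frobB _ _) _; rewrite lerD2l.
have H7 : 2 * q * L * frob h < 1.
  have := H4; rewrite -[_^-1]mul1r ltr_pdivlMr; last by rewrite -invr_gt0.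
  move=> H; apply: le_lt_trans H; rewrite mulrC ler_wpM2l // lerDl ler01 //.
have H8 : 2 * q * frob D <= frob h.
  apply: le_trans (ltW H3); rewrite ler_wpM2r // (le_trans H5) //.
  by rewrite ler_nat.
nra.
Qed.

End surface_constants.

(** * Uniform bounds on the admissible class *)

Section admissible_bounds.
Variables (R : realType) (m n : nat) (Omega : set 'cV[R]_2) (x : 'cV[R]_2 -> 'cV[R]_m).
Variable T : mesh Omega x.
Hypothesis x_inj : set_inj Omega x.
Hypothesis x_diff : differentiable_in Omega x.
Hypothesis x_lip : exists L : R, lipschitz_with Omega (jacobian_in Omega x) id L.
Hypothesis x_rank : forall w, Omega w -> \rank (jacobian_in Omega x w) = 2%N.
Variables (N : set 'cV[R]_n) (CL : R).
Hypothesis CL_gt0 : 0 < CL.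

Local Notation Dx := (jacobian_in Omega x).
Local Notation Df f := (jacobian_in Omega (f \o x)).
Local Notation adm := (admissible Omega x N CL).
Implicit Type f : 'cV[R]_m -> 'cV[R]_n.

(** The infimum of the Lipschitz constants is attained, as the Lipschitz
    condition is closed in the constant. *)
Lemma tgrad_lip_constP f :
  (tgrad_lip_const Omega x f <= CL%:E)%E <-> lipschitz_with Omega (tgrad Omega x f) x CL.
Proof.
split => [h w w' Ow Ow'|h]; last first.
  by apply: ereal_inf_lbound; exists CL => //; split => //; exact: ltW.
have c0 : 0 < frob (x w - x w') + 1 by rewrite ltr_wpDl.
apply/ler_addgt0Pr => e e0.
have : (tgrad_lip_const Omega x f < (CL + e / (frob (x w - x w') + 1))%:E)%E.
  by apply: le_lt_trans h _; rewrite lte_fin ltrDl divr_gt0.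
move/ereal_inf_lt => [_ [K [K0 hK] <-]]; rewrite lte_fin => hlt.
apply: le_trans (hK _ _ Ow Ow') _.
apply: le_trans (ler_wpM2r (frob_ge0 _) (ltW hlt)) _.
rewrite mulrDl lerD2l mulrAC -mulrA ler_piMr ?(ltW e0) //.
by rewrite ler_pdivrMr // mul1r lerDl.
Qed.

(** The Moore-Penrose inverse of Dx. *)
Definition param_pinv w : 'M[R]_(2, m) := invmx (gram Omega x w) *m (Dx w)^T.

Lemma tgradE f w : tgrad Omega x f w = Df f w *m param_pinv w.
Proof. by rewrite /tgrad /param_pinv mulmxA. Qed.

Lemma gram_unit w : Omega w -> gram Omega x w \in unitmx.
Proof.
move=> Ow; rewrite -row_free_unit -kermx_eq0; apply/eqP/row_matrixP => i.
rewrite row0; set r := row i _.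
have r0 : r *m gram Omega x w = 0 by rewrite -row_mul mulmx_ker row0.
apply: (can_inj (@trmxK _ _ _)); rewrite trmx0; apply: (rank2_inj (x_rank Ow)).
apply: frob_eq0; rewrite frobE ip_mull.
rewrite (_ : _ *m (_ *m r^T) = (r *m gram Omega x w)^T); last first.
  by rewrite trmx_mul /gram trmx_mul trmxK mulmxA.
by rewrite r0 trmx0 ip0r sqrtr0.
Qed.

Lemma param_pinvK w : Omega w -> param_pinv w *m Dx w = 1%:M.
Proof. by move=> Ow; rewrite /param_pinv -mulmxA mulVmx // gram_unit. Qed.

Lemma tgrad_mul_Dx f w : Omega w -> tgrad Omega x f w *m Dx w = Df f w.
Proof. by move=> Ow; rewrite tgradE -mulmxA param_pinvK // mulmx1. Qed.

(** The orthogonal projector onto the tangent plane at x w. *)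
Definition tan_proj w : 'M[R]_m := Dx w *m param_pinv w.

Lemma tr_tan_proj w : (tan_proj w)^T = tan_proj w.
Proof.
rewrite /tan_proj /param_pinv !trmx_mul trmxK trmx_inv mulmxA; congr (_ *m invmx _ *m _).
by rewrite /gram trmx_mul trmxK.
Qed.

Lemma tan_proj_Dx w : Omega w -> tan_proj w *m Dx w = Dx w.
Proof. by move=> Ow; rewrite /tan_proj -mulmxA param_pinvK // mulmx1. Qed.

Lemma tan_proj_idem w : Omega w -> tan_proj w *m tan_proj w = tan_proj w.
Proof. by move=> Ow; rewrite {2}/tan_proj mulmxA tan_proj_Dx. Qed.

Lemma mxtrace_tan_proj w : Omega w -> \tr (tan_proj w) = 2.
Proof. by move=> Ow; rewrite /tan_proj mxtrace_mulC param_pinvK // mxtrace1. Qed.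

Lemma tgrad_tan_proj f w : Omega w -> tgrad Omega x f w *m tan_proj w = tgrad Omega x f w.
Proof. by move=> Ow; rewrite /tan_proj mulmxA tgrad_mul_Dx // tgradE. Qed.

Lemma adm_jacobian f w : adm f -> Omega w -> has_jacobian_in Omega (f \o x) w (Df f w).
Proof.
by move=> [df _ _] /df [J hJ]; exact: (xgetPex 0 (ex_intro _ J hJ)).
Qed.

Lemma adm_lip f w w' : adm f -> Omega w -> Omega w' ->
  frob (tgrad Omega x f w - tgrad Omega x f w') <= CL * frob (x w - x w').
Proof. by move=> [_ _ /tgrad_lip_constP h] Ow Ow'; exact: h. Qed.

Lemma adm_range f w : adm f -> Omega w -> N (f (x w)).
Proof. by move=> [_ <- _] Ow; exists (x w) => //; exists w. Qed.

Lemma N_bounded : adm !=set0 -> exists2 B : R, 0 <= B & forall y, N y -> frob y <= B.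
Proof.
move=> [f0 [df <- _]]; have [B B0 hB] := diff_bounded T df.
by exists B => // _ [_ [w Ow <-] <-]; exact: hB.
Qed.

(** The derivative of f o x is tgrad f times Dx.  Along the segment the first
    factor oscillates by at most CL * b, as the points of the surface stay
    within b of x w, and the second by at most L times the length. *)
Lemma adm_increment f w w' Xm L b : adm f -> segment_in Omega w w' ->
  0 <= Xm -> 0 <= L -> 0 <= b ->
  (forall p, Omega p -> frob (Dx p) <= Xm) ->
  (forall p q, Omega p -> Omega q -> frob (Dx p - Dx q) <= L * frob (p - q)) ->
  (forall s, 0 <= s <= 1 -> frob (x (w + s *: (w' - w)) - x w) <= b) ->
  frob (f (x w') - f (x w) - Df f w *m (w' - w)) <=
    (CL * b * Xm + frob (tgrad Omega x f w) * (L * frob (w' - w))) * frob (w' - w).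
Proof.
move=> af seg Xm0 L0 b0 hXm hL hb.
have Ow := segment_in_l seg.
apply: (@mean_value_ineq _ _ _ Omega (f \o x) (Df f)).
- exact: seg.
- by move=> t t01; apply: adm_jacobian => //; exact: seg.
- move=> t t01; apply: le_trans (frobM _ _) _; rewrite ler_wpM2r //.
  have Ot := seg t t01; set p := w + t *: _.
  rewrite -!tgrad_mul_Dx //.
  have -> : tgrad Omega x f p *m Dx p - tgrad Omega x f w *m Dx w =
    (tgrad Omega x f p - tgrad Omega x f w) *m Dx p
    + tgrad Omega x f w *m (Dx p - Dx w).
    by rewrite mulmxBl mulmxBr addrA subrK.
  apply: le_trans (frobD _ _) _; rewrite lerD //.
    apply: le_trans (frobM _ _) _; apply: ler_pM => //; last exact: hXm.
    apply: le_trans (adm_lip af Ot Ow) _.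
    by rewrite ler_wpM2l ?(ltW CL_gt0) // hb.
  apply: le_trans (frobM _ _) _; rewrite ler_wpM2l //.
  apply: le_trans (hL _ _ Ot Ow) _; rewrite ler_wpM2l //.
  rewrite /p addrAC subrr add0r frobZ.
  by case/andP: t01 => t0 t1; rewrite ger0_norm // ler_piMl.
Qed.

(** The values of f lie in the bounded set N and tgrad f oscillates by at most
    CL (bx + bx), so difference quotients over one fixed triangle bound tgrad f
    at its vertex w0.  The oscillation of Dx contributes a term with frob A0
    itself; shrinking the triangle by the factor s makes that term absorbable. *)
Lemma tgrad_bounded : exists2 a : R, 0 <= a & forall f w, adm f -> Omega w ->
  frob (tgrad Omega x f w) <= a.
Proof.
have [[w1 Ow1]|hO] := pselect (Omega !=set0); last first.
  by exists 0 => // f w _ Ow; exfalso; apply: hO; exists w.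
have [hF|hF] := pselect (adm !=set0); last first.
  by exists 0 => // f w af; exfalso; apply: hF; exists f.
have [BN BN0 hBN] := N_bounded hF.
have [L L0 hL] := x_lip_ge0 x_lip.
have [Xm Xm0 hXm] := Dx_bounded T x_lip.
have [bx bx0 hbx] := x_bounded T x_diff.
have [t _] := mesh_hullP T Ow1.
set v := mesh_tri t; set w0 := v 0.
have Ow0 : Omega w0 by apply: (@mesh_hull_sub _ _ _ _ T t); exact: hull_vertex.
set D := \sum_l frob (v l - w0).
have D0 : 0 <= D by apply: sumr_ge0.
have hD l : frob (v l - w0) <= D by rewrite /D (bigD1 l) //= lerDl sumr_ge0.
set beta := frob (param_pinv w0) * \sum_l frob (bary_grad v l).
have b0 : 0 <= beta by rewrite mulr_ge0 // sumr_ge0.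
have betaE : beta = frob (param_pinv w0) * \sum_l frob (bary_grad v l) by [].
clearbody beta.
set K1 := CL * (bx + bx) * Xm.
have K10 : 0 <= K1 by rewrite !mulr_ge0 ?addr_ge0 // ltW.
have K1E : K1 = CL * (bx + bx) * Xm by [].
clearbody K1.
have q0 : 0 <= 2 * beta * L * D ^+ 2.
  by rewrite -!mulrA mulr_ge0 // (mulr_ge0 b0) // mulr_ge0 // sqr_ge0.
have den0 : 0 < 2 * beta * L * D ^+ 2 + 1 by rewrite ltr_wpDl.
(* With this s the coefficient of frob A0 in H below is at most one half. *)
pose s := (2 * beta * L * D ^+ 2 + 1)^-1.
have s0 : 0 < s by rewrite invr_gt0.
have s1 : s <= 1 by rewrite invf_le1 // lerDr.
pose C0 := (BN + BN) / s + K1 * D.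
have C00 : 0 <= C0.
  by rewrite addr_ge0 ?mulr_ge0 // ?addr_ge0 // invr_ge0 ltW.
exists (2 * beta * C0 + CL * (bx + bx)).
  rewrite addr_ge0 ?(mulr_ge0 (mulr_ge0 _ b0)) //.
  by rewrite mulr_ge0 ?addr_ge0 // ltW.
move=> f w af Ow; set A0 := tgrad Omega x f w0.
have osc : frob (tgrad Omega x f w - A0) <= CL * (bx + bx).
  apply: le_trans (adm_lip af Ow Ow0) _; rewrite ler_wpM2l ?(ltW CL_gt0) //.
  by apply: le_trans (frobB _ _) _; rewrite lerD // hbx.
suff hA0 : frob A0 <= 2 * beta * C0.
  rewrite -(subrK A0 (tgrad _ _ _ _)); apply: le_trans (frobD _ _) _.
  by rewrite addrC lerD.
have hJ l : frob (Df f w0 *m (v l - w0)) <= C0 + frob A0 * L * D ^+ 2 * s.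
  pose p := w0 + s *: (v l - w0).
  have seg0 : segment_in Omega w0 (v l).
    by apply: (@mesh_segment _ _ _ _ T t); exact: hull_vertex.
  have seg : segment_in Omega w0 p.
    by apply: segment_in_sub => //; rewrite (ltW s0).
  have hp : p - w0 = s *: (v l - w0) by rewrite /p addrAC subrr add0r.
  have osc_x r : 0 <= r <= 1 -> frob (x (w0 + r *: (p - w0)) - x w0) <= bx + bx.
    move=> r01; apply: le_trans (frobB _ _) _; rewrite lerD // hbx //; exact: seg.
  have := adm_increment af seg Xm0 L0 (addr_ge0 bx0 bx0) hXm hL osc_x.
  rewrite -K1E -/A0 hp -scalemxAr => H.
  have H1 : frob (s *: (Df f w0 *m (v l - w0))) <=
     BN + BN + (K1 + frob A0 * (L * frob (s *: (v l - w0)))) * frob (s *: (v l - w0)).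
    have E : s *: (Df f w0 *m (v l - w0)) =
      (f (x p) - f (x w0)) - (f (x p) - f (x w0) - s *: (Df f w0 *m (v l - w0))).
      by rewrite subKr.
    rewrite E; apply: le_trans (frobB _ _) _; rewrite lerD //.
    apply: le_trans (frobB _ _) _; rewrite lerD // hBN //; apply: adm_range => //.
    exact: segment_in_r seg.
  rewrite !frobZ (gtr0_norm s0) in H1.
  have Hd := hD l.
  have d0 := frob_ge0 (v l - w0).
  have A00 := frob_ge0 A0.
  rewrite -(ler_pM2l s0); apply: le_trans H1 _.
  rewrite /C0.
  have -> : s * ((BN + BN) / s + K1 * D + frob A0 * L * D ^+ 2 * s) =
     BN + BN + (K1 + frob A0 * (L * (s * D))) * (s * D).
    by field; rewrite gt_eqF.
  rewrite lerD2l; apply: ler_pM.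
  - by rewrite addr_ge0 // !mulr_ge0 // ltW.
  - by rewrite mulr_ge0 // ltW.
  - by rewrite lerD2l !ler_wpM2l // ltW.
  - by rewrite ler_wpM2l // ltW.
have E : A0 = \sum_l ((Df f w0 *m (v l - w0)) *m (bary_grad v l)^T) *m param_pinv w0.
  rewrite -mulmx_suml (sum_mul_bary_grad (mesh_nondeg t)).
  by rewrite (tri_proj1 (mesh_nondeg t)) mulmx1 /A0 tgradE.
have H : frob A0 <= beta * (C0 + frob A0 * L * D ^+ 2 * s).
  rewrite {1}E; apply: le_trans (frob_sum _ _ _) _.
  rewrite betaE mulr_sumr mulr_suml; apply: ler_sum => l _.
  apply: le_trans (frobM _ _) _; rewrite -mulrA [leRHS]mulrC ler_wpM2r //.
  apply: le_trans (frobM _ _) _; rewrite frob_tr [leRHS]mulrC ler_wpM2r //.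
have hs : 2 * (beta * (L * D ^+ 2 * s)) <= 1.
  have -> : 2 * (beta * (L * D ^+ 2 * s)) = (2 * beta * L * D ^+ 2) * s by ring.
  by rewrite /s ler_pdivrMr // mul1r lerDl.
have := ler_wpM2l (frob_ge0 A0) hs.
lra.
Qed.

Lemma adm_taylor : exists2 K : R, 0 <= K &
  forall f w w', adm f -> segment_in Omega w w' ->
  frob (f (x w') - f (x w) - Df f w *m (w' - w)) <= K * frob (w' - w) ^+ 2.
Proof.
have [a a0 ha] := tgrad_bounded.
have [L L0 hL] := x_lip_ge0 x_lip.
have [Xm Xm0 hXm] := Dx_bounded T x_lip.
have [B B0 hB] := x_lipschitz T x_diff x_lip.
exists (CL * B * Xm + a * L).
  by rewrite addr_ge0 // !mulr_ge0 // ltW.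
move=> f w w' af seg.
have Ow := segment_in_l seg.
have osc_x r : 0 <= r <= 1 ->
    frob (x (w + r *: (w' - w)) - x w) <= B * frob (w' - w).
  move=> r01; apply: le_trans (hB _ _ (segment_in_sub r01 seg)) _.
  rewrite ler_wpM2l // addrAC subrr add0r frobZ.
  by case/andP: r01 => r0 r1; rewrite ger0_norm // ler_piMl.
have H := adm_increment af seg Xm0 L0 (mulr_ge0 B0 (frob_ge0 _)) hXm hL osc_x.
apply: le_trans H _.
have := ler_wpM2r (mulr_ge0 L0 (sqr_ge0 (frob (w' - w)))) (ha f w af Ow).
lra.
Qed.

End admissible_bounds.

(** * Consistency of the discrete gradient *)

Section projectors.
Variables (R : realType) (m : nat).

Lemma sqr_frob_proj_compl (P Q : 'M[R]_m) :
  P^T = P -> P *m P = P -> Q^T = Q -> Q *m Q = Q ->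
  frob ((1%:M - P) *m Q) ^+ 2 = \tr Q - \tr (P *m Q).
Proof.
move=> Pt PP Qt QQ.
have h1 : (1%:M - P)^T = 1%:M - P by rewrite linearB /= trmx1 Pt.
have h2 : (1%:M - P) *m (1%:M - P) = 1%:M - P.
  by rewrite mulmxBl mul1mx mulmxBr mulmx1 PP subrr subr0.
rewrite sqr_frob ip_mull h1 mulmxA h2 /ip Qt mxtrace_mulC -mulmxA QQ.
by rewrite mulmxBl mul1mx raddfB.
Qed.

(** The squares of both sides are tr Q - tr (P Q) and tr P - tr (Q P): for
    projectors of equal trace the gap between their ranges is symmetric. *)
Lemma frob_proj_gap (P Q : 'M[R]_m) :
  P^T = P -> P *m P = P -> Q^T = Q -> Q *m Q = Q -> \tr P = \tr Q ->
  frob (Q *m (1%:M - P)) = frob ((1%:M - Q) *m P).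
Proof.
move=> Pt PP Qt QQ tPQ.
have -> : frob (Q *m (1%:M - P)) = frob ((1%:M - P) *m Q).
  by rewrite -frob_tr trmx_mul Qt linearB /= trmx1 Pt.
apply/eqP; rewrite -(eqrXn2 (n := 2)) ?frob_ge0 //.
by rewrite !sqr_frob_proj_compl // tPQ (mxtrace_mulC P).
Qed.

Lemma frob_proj_le (Q : 'M[R]_m) :
  Q^T = Q -> Q *m Q = Q -> \tr Q = 2 -> frob Q <= 2.
Proof.
move=> Qt QQ tQ; rewrite -ler_sqr ?nnegrE // sqr_frob /ip Qt QQ tQ.
by rewrite expr2; lra.
Qed.

Lemma frob_vertex_le_diam (v : 'I_3 -> 'cV[R]_m) k l : frob (v k - v l) <= diam v.
Proof.
have d0 : 0 <= diam v by apply: le_trans (len_le_diam v 0).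
have [->|->|->] := ord3_shiftP l k.
- by rewrite subrr frob0.
- rewrite frobBC; have := len_le_diam v (l + 2).
  by rewrite /edge !ord3_shift.
- have := len_le_diam v (l + 1).
  by rewrite /edge !ord3_shift.
Qed.

Lemma sum_subr_bary_grad p (v : 'I_3 -> 'cV[R]_m) (g : 'I_3 -> 'cV[R]_p) c :
  0 < area v ->
  \sum_l (g l - c) *m (bary_grad v l)^T = \sum_l g l *m (bary_grad v l)^T.
Proof.
move=> v0; under eq_bigr do rewrite mulmxBl.
rewrite big_split sumrN /= -mulmx_sumr -linear_sum sum_bary_grad //=.
by rewrite trmx0 mulmx0 subr0.
Qed.

Lemma mul_tr_bary_mx p (v : 'I_3 -> 'cV[R]_m) (g : 'I_3 -> 'cV[R]_p) :
  (\matrix_(r < p, l < 3) g l r 0) *m (bary_mx v)^T =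
  \sum_l g l *m (bary_grad v l)^T.
Proof.
apply/matrixP => i j; rewrite !mxE summxE; apply: eq_bigr => l _.
by rewrite !mxE big_ord1 !mxE.
Qed.

End projectors.

Section consistency.
Variables (R : realType) (m n : nat) (Omega : set 'cV[R]_2) (x : 'cV[R]_2 -> 'cV[R]_m).
Variable T0 : mesh Omega x.
Hypothesis x_inj : set_inj Omega x.
Hypothesis x_diff : differentiable_in Omega x.
Hypothesis x_lip : exists L : R, lipschitz_with Omega (jacobian_in Omega x) id L.
Hypothesis x_rank : forall w, Omega w -> \rank (jacobian_in Omega x w) = 2%N.
Variables (N : set 'cV[R]_n) (CL : R).
Hypothesis CL_gt0 : 0 < CL.

Local Notation Dx := (jacobian_in Omega x).
Local Notation adm := (admissible Omega x N CL).

Definition disc_grad (T : mesh Omega x) (t : 'I_(mesh_card T))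
    (f : 'cV[R]_m -> 'cV[R]_n) : 'M[R]_(n, m) :=
  (\matrix_(r < n, l < 3) f (mesh_V t l) r 0) *m (bary_mx (mesh_V t))^T.

(** With S l and E l the Taylor remainders of x and f o x at the vertices, the
    error is the sum of the (E l - A S l) b_l^T minus A Q (1 - P), and the
    symmetric gap (1 - Q) P involves the remainders S l only. *)
Lemma disc_grad_consistent : exists2 C : R, 0 <= C &
  forall (T : mesh Omega x) t f w, adm f -> hull (@mesh_tri _ _ _ _ T t) w ->
    frob (disc_grad t f - tgrad Omega x f w) <= C * mesh_ratio T.
Proof.
have [a a0 ha] := tgrad_bounded T0 x_diff x_lip x_rank N CL_gt0.
have [Kf Kf0 hKf] := adm_taylor T0 x_diff x_lip x_rank N CL_gt0.
have [Kx Kx0 hKx] := x_taylor x_diff x_lip.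
have [cb cb0 hcb] := x_bilipschitz T0 x_inj x_diff x_lip x_rank.
(* The 4 collects one Taylor remainder of x from the expansion of f and three
   from the gap between the projectors; the 6 below comes from three vertices
   and the factor 2 of the shape estimate. *)
pose K := (Kf + 4 * a * Kx) * cb ^+ 2.
have K0 : 0 <= K.
  by rewrite mulr_ge0 ?sqr_ge0 // addr_ge0 // !mulr_ge0.
exists (6 * K); first by rewrite mulr_ge0.
move=> T t f w af hw.
have Ow : Omega w by exact: (@mesh_hull_sub _ _ _ _ T t).
set om := mesh_tri t in hw *; set v := mesh_V t.
have v0 : 0 < area v by exact: mesh_V_nondeg.
have seg l : segment_in Omega w (om l).
  by apply: (@mesh_segment _ _ _ _ T t) => //; exact: hull_vertex.
set d := diam v.
have d0 : 0 <= d by apply: le_trans (len_le_diam v 0).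
have dist l : frob (om l - w) <= cb * d.
  rewrite frobBC; apply: (hull_dist hw) => k.
  apply: le_trans (hcb (om l) (om k) _) _.
    by apply: (@mesh_segment _ _ _ _ T t); exact: hull_vertex.
  by rewrite ler_wpM2l ?(ltW cb0) //; exact: frob_vertex_le_diam.
set A := tgrad Omega x f w; set Q := tan_proj Omega x w; set P := tri_proj v.
have AQ : A *m Q = A by exact: tgrad_tan_proj.
have Qt : Q^T = Q by exact: tr_tan_proj.
have QQ : Q *m Q = Q by exact: tan_proj_idem.
have tQ : \tr Q = 2 by exact: mxtrace_tan_proj.
have Pt : P^T = P by exact: tr_tri_proj.
have PP : P *m P = P by exact: tri_proj_idem.
have tP : \tr P = 2 by exact: mxtrace_tri_proj.
pose S l := v l - x w - Dx w *m (om l - w).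
pose E l := f (v l) - f (x w) - jacobian_in Omega (f \o x) w *m (om l - w).
have hS l : frob (S l) <= Kx * (cb * d) ^+ 2.
  apply: le_trans (hKx _ _ (seg l)) _; rewrite ler_wpM2l //.
  by rewrite ler_sqr ?nnegrE ?mulr_ge0 // ltW.
have hE l : frob (E l) <= Kf * (cb * d) ^+ 2.
  apply: le_trans (hKf _ _ _ af (seg l)) _; rewrite ler_wpM2l //.
  by rewrite ler_sqr ?nnegrE ?mulr_ge0 // ltW.
have eqP1 : (1%:M - Q) *m P = \sum_l ((1%:M - Q) *m S l) *m (bary_grad v l)^T.
  rewrite -(sum_mul_bary_grad v0 _ (x w)); apply: eq_bigr => l _; congr (_ *m _).
  have Z : (1%:M - Q) *m Dx w = 0 by rewrite mulmxBl mul1mx tan_proj_Dx // subrr.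
  by rewrite /S [in RHS]mulmxBr (mulmxA (1%:M - Q) (Dx w)) Z mul0mx subr0.
have eqG : disc_grad t f - A = \sum_l (E l - A *m S l) *m (bary_grad v l)^T
    - A *m (Q *m (1%:M - P)).
  rewrite /disc_grad mul_tr_bary_mx -/v -(sum_subr_bary_grad _ (f (x w)) v0).
  rewrite mulmxA AQ mulmxBr mulmx1 opprB addrA; congr (_ - _).
  rewrite /P -(sum_mul_bary_grad v0 _ (x w)) -big_split /=.
  apply: eq_bigr => l _; rewrite -mulmxDl; congr (_ *m _).
  rewrite /E /S -(tgrad_mul_Dx x_rank f Ow) -/A !mulmxBr !mulmxA.
  move: (f (v l)) (f (x w)) (A *m v l) (A *m x w) (A *m Dx w *m om l) (A *m Dx w *m w).
  by move=> ? ? ? ? ? ?; apply/matrixP => i j; rewrite !mxE; ring.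
have hA : frob A <= a by exact: ha.
have gap : frob (Q *m (1%:M - P)) <= \sum_l 3 * frob (S l) * frob (bary_grad v l).
  rewrite frob_proj_gap ?tP ?tQ // eqP1; apply: le_trans (frob_sum _ _ _) _.
  apply: ler_sum => l _; apply: le_trans (frobM _ _) _.
  rewrite frob_tr ler_wpM2r // mulmxBl mul1mx; apply: le_trans (frobB _ _) _.
  have := frobM Q (S l); have := ler_wpM2r (frob_ge0 (S l)) (frob_proj_le Qt QQ tQ).
  lra.
have main : frob (disc_grad t f - A) <=
    \sum_l (frob (E l) + 4 * a * frob (S l)) * frob (bary_grad v l).
  rewrite eqG; apply: le_trans (frobB _ _) _.
  have -> : \sum_l (frob (E l) + 4 * a * frob (S l)) * frob (bary_grad v l) =
    \sum_l (frob (E l) + a * frob (S l)) * frob (bary_grad v l) +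
    a * \sum_l 3 * frob (S l) * frob (bary_grad v l).
    by rewrite mulr_sumr -big_split; apply: eq_bigr => l _ /=; ring.
  rewrite lerD //.
    apply: le_trans (frob_sum _ _ _) _; apply: ler_sum => l _.
    apply: le_trans (frobM _ _) _; rewrite frob_tr ler_wpM2r //.
    apply: le_trans (frobB _ _) _; rewrite lerD2l.
    by apply: le_trans (frobM _ _) _; rewrite ler_wpM2r.
  by apply: le_trans (frobM _ _) _; apply: ler_pM.
apply: le_trans main _.
have rho : d / sin (min_angle v) <= mesh_ratio T.
  exact: (@le_bigmax_cond _ _ _ _ t _
    (fun t => diam (mesh_V t) / sin (min_angle (mesh_V t)))).
apply: le_trans (_ : \sum_(l < 3) (K * (2 * mesh_ratio T)) <= _); last first.
  by rewrite sum_ord3; lra.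
apply: ler_sum => l _.
apply: le_trans (_ : K * (frob (bary_grad v l) * d ^+ 2) <= _); last first.
  rewrite ler_wpM2l //; apply: le_trans (frob_bary_grad_le v0 l) _.
  by rewrite ler_wpM2l.
have -> : K * (frob (bary_grad v l) * d ^+ 2) =
  (Kf * (cb * d) ^+ 2 + 4 * a * (Kx * (cb * d) ^+ 2)) * frob (bary_grad v l).
  by rewrite /K; ring.
by rewrite ler_wpM2r // lerD // ler_wpM2l // mulr_ge0.
Qed.

End consistency.

(** * Measure of planar triangles *)

Section plane_measure.
Variable R : realType.

Local Notation mu2 := (@lebesgue_measure R \x @lebesgue_measure R)%E.
Local Notation cV := (@cV_of_pair R).

Lemma measurable_affine (a b c : R) :
  measurable_fun [set: R * R] (fun p : R * R => a + b * p.1 + c * p.2).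
Proof.
apply: measurable_funD; first apply: measurable_funD.
- exact: measurable_cst.
- by apply: measurable_funM; [exact: measurable_cst | exact: measurable_fst].
- by apply: measurable_funM; [exact: measurable_cst | exact: measurable_snd].
Qed.

(** Every vertical section of a line is a point, unless the line is vertical,
    when it is a product with a null factor. *)
Lemma line_null (a b c : R) : (b != 0) || (c != 0) ->
  mu2 [set p : R * R | a + b * p.1 + c * p.2 = 0] = 0.
Proof.
have [->|c0 _] := eqVneq c 0.
  rewrite orbF => b0.
  have -> : [set p : R * R | a + b * p.1 + 0 * p.2 = 0] = [set - a / b] `*` setT.
    apply/seteqP; split => -[p q] /=.
      rewrite mul0r addr0 => E; split => //=.
      by apply: (mulfI b0); rewrite mulrCA divff // mulr1; lra.
    by move=> [-> _]; rewrite mul0r addr0 mulrCA divff //; lra.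
  rewrite product_measure1E //.
  apply/eqP; rewrite mule_eq0; apply/orP; left; apply/eqP.
  exact: lebesgue_measure_set1.
rewrite /product_measure1.
rewrite (eq_integral (fun=> 0%E)) ?integral0 // => u _ /=.
have -> : xsection [set p : R * R | a + b * p.1 + c * p.2 = 0] u =
    [set - (a + b * u) / c].
  apply/seteqP; split => q; rewrite /xsection /= inE /=.
    move=> E; apply: (mulfI c0); rewrite mulrCA divff // mulr1; lra.
  by move=> ->; rewrite mulrCA divff //; lra.
exact: lebesgue_measure_set1.
Qed.

Variable v : 'I_3 -> 'cV[R]_2.
Hypothesis v_nondeg : 0 < area v.

Lemma bary_affine l (p : R * R) : bary v l (cV p) =
  bary v l 0 + bary_grad v l 0 0 * p.1 + bary_grad v l 1 0 * p.2.
Proof.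
rewrite /bary; have -> : cV p - v 0 = cV p + (0 - v 0) by rewrite sub0r.
rewrite ipDr -!addrA; congr (_ + _); rewrite addrC; congr (_ + _).
rewrite ipE !big_ord_recl !big_ord0 !addr0 ![cV p _ _]mxE /=.
by congr (_ + bary_grad v l _ _ * _); apply: val_inj.
Qed.

(** Inside the interior of the hull and equal to the hull up to three lines, so
    it serves for disjointness and for integration alike. *)
Definition open_tri : set 'cV[R]_2 := [set w | forall l, 0 < bary v l w].

Lemma measurable_bary l : measurable_fun [set: R * R] (fun p => bary v l (cV p)).
Proof.
under eq_fun do rewrite bary_affine.
exact: measurable_affine.
Qed.

Lemma all3E (P : 'I_3 -> set (R * R)) :
  [set p | forall l, P l p] = P 0 `&` P 1 `&` P 2.
Proof.
by apply/seteqP; split => p /= => [h|[[h0 h1] h2]]; [do !split | exact: ord3W].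
Qed.

Lemma measurable_hull : measurable (cV @^-1` hull v).
Proof.
have m1 l : measurable [set p | 0 <= bary v l (cV p)].
  have -> : [set p | 0 <= bary v l (cV p)] =
      setT `&` (fun p => bary v l (cV p)) @^-1` `[0, +oo[.
    by apply/seteqP; split => p /=; rewrite in_itv /= andbT; tauto.
  by apply: measurable_bary => //; exact: measurable_itv.
have -> : cV @^-1` hull v = [set p | forall l, [set p | 0 <= bary v l (cV p)] p].
  by apply/seteqP; split => p /=; move/(hullP v_nondeg).
by rewrite all3E; apply: measurableI => //; apply: measurableI.
Qed.

Lemma measurable_open_tri : measurable (cV @^-1` open_tri).
Proof.
have m1 l : measurable [set p | 0 < bary v l (cV p)].
  have -> : [set p | 0 < bary v l (cV p)] =
      setT `&` (fun p => bary v l (cV p)) @^-1` `]0, +oo[.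
    by apply/seteqP; split => p /=; rewrite in_itv /= andbT; tauto.
  by apply: measurable_bary => //; exact: measurable_itv.
have -> : cV @^-1` open_tri = [set p | forall l, [set p | 0 < bary v l (cV p)] p] by [].
by rewrite all3E; apply: measurableI => //; apply: measurableI.
Qed.

Lemma open_tri_sub : open_tri `<=` hull v.
Proof. by move=> w h; apply/hullP => // l; exact/ltW/h. Qed.

Lemma bary_line_null l : mu2.-negligible [set p : R * R | bary v l (cV p) = 0].
Proof.
have mA : measurable [set p : R * R | bary v l (cV p) = 0].
  rewrite -[X in measurable X]setTI.
  exact: (measurable_bary l measurableT (measurable_set1 0)).
exists [set p : R * R | bary v l (cV p) = 0]; split => // {mA}.
have -> : [set p : R * R | bary v l (cV p) = 0] =
  [set p | bary v l 0 + bary_grad v l 0 0 * p.1 + bary_grad v l 1 0 * p.2 = 0].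
  by apply/seteqP; split => p /=; rewrite bary_affine.
apply: line_null; apply: contraT; rewrite negb_or !negbK => /andP[/eqP b0 /eqP b1].
have : 0 < frob (bary_grad v l).
  by rewrite frob_bary_grad // divr_gt0 ?len_gt0 // area2_gt0.
have -> : bary_grad v l = 0; last by rewrite frob0 ltxx.
apply/matrixP => i j; rewrite ord1 [RHS]mxE.
case: i => [[|[|//]] i]; [rewrite -[RHS]b0|rewrite -[RHS]b1];
  by congr (bary_grad v l _ _); apply: val_inj.
Qed.

Lemma hull_setD_null :
  mu2.-negligible (cV @^-1` hull v `\` cV @^-1` open_tri).
Proof.
apply: negligibleS (negligibleU (negligibleU (bary_line_null 0) (bary_line_null 1))
  (bary_line_null 2)).
move=> p [/(hullP v_nondeg) h nh] /=.
apply: contrapT => hn; apply: nh => l; rewrite lt_def h andbT.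
apply/eqP; move: l; apply: ord3W => E; apply: hn; tauto.
Qed.

End plane_measure.

Section continuous_measurable.
Variable R : realType.

(** Relatively open sets of the plane are countable unions of relatively open
    boxes with rational corners. *)
Lemma continuous_in_measurable (D : set (R * R)) (g : R * R -> R) :
  (forall p, D p -> g q @[q --> within D (nbhs p)] --> g p) ->
  measurable_fun D g.
Proof.
move=> gc mD; apply: (measurability _ (RGenOInfty.measurableE R)) => //.
move=> _ [_ [y ->] <-].
pose box (r : rat * rat * (rat * rat)) : set (R * R) :=
  `]ratr r.1.1, ratr r.1.2[%classic `*` `]ratr r.2.1, ratr r.2.2[%classic.
pose F r := if pselect (forall q, D q -> box r q -> y < g q) then box r else set0.
have -> : D `&` g @^-1` `]y, +oo[ = D `&` \bigcup_r F r.
  apply/seteqP; split => p [Dp]; rewrite /= ?in_itv /= ?andbT.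
    move=> yg; split => //.
    have : \forall q \near within D (nbhs p), y < g q by exact: (cvgr_gt _ (gc p Dp)).
    case/nbhs_ballP => e e0 he.
    have lt1 (u : R) : u - e < u by rewrite ltrBlDr ltrDl.
    have lt2 (u : R) : u < u + e by rewrite ltrDl.
    have [a1] := rat_in_itvoo (lt1 p.1); rewrite in_itv /= => /andP[a1l a1r].
    have [b1] := rat_in_itvoo (lt2 p.1); rewrite in_itv /= => /andP[b1l b1r].
    have [a2] := rat_in_itvoo (lt1 p.2); rewrite in_itv /= => /andP[a2l a2r].
    have [b2] := rat_in_itvoo (lt2 p.2); rewrite in_itv /= => /andP[b2l b2r].
    exists ((a1, b1), (a2, b2)) => //; rewrite /F; case: pselect => /= [_|].
      by split; rewrite /= in_itv /= ?a1r ?b1l ?a2r ?b2l.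
    case=> q Dq; rewrite /box /= !in_itv /= => -[/andP[q1 q2] /andP[q3 q4]].
    apply: he Dq; split; rewrite /ball /= ltr_norml; apply/andP; split; lra.
  move=> [r _]; rewrite /F; case: pselect => /= [h br|//]; split => //.
  exact: (h p).
apply: measurableI => //; apply: countable_bigcupT_measurable => // r.
rewrite /F; case: pselect => /= [?|?]; last exact: measurable0.
by apply: measurableX; exact: measurable_itv.
Qed.

End continuous_measurable.

Lemma det_mx22E (R : comNzRingType) (A : 'M[R]_2) :
  \det A = A 0 0 * A 1 1 - A 0 1 * A 1 0.
Proof.
rewrite (expand_det_row _ 0) !big_ord_recl big_ord0 addr0 /cofactor !det_mx11 !mxE /=.
rewrite expr0 expr1 mul1r mulN1r mulrN.
by congr (_ * A _ _ - A _ _ * A _ _); apply: val_inj.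
Qed.

(** Bundled with its measure structure, which unification does not recover from
    the bare set function in surface_integral. *)
Definition plane_measure (R : realType) : {measure set _ -> \bar R} :=
  (@lebesgue_measure R \x @lebesgue_measure R)%E.
Arguments plane_measure {R}.

Section surface_integrals.
Variables (R : realType) (m : nat) (Omega : set 'cV[R]_2) (x : 'cV[R]_2 -> 'cV[R]_m).
Variable T0 : mesh Omega x.
Hypothesis x_lip : exists L : R, lipschitz_with Omega (jacobian_in Omega x) id L.

Local Notation mu2 := (@lebesgue_measure R \x @lebesgue_measure R)%E.
Local Notation cV := (@cV_of_pair R).
Local Notation elt w := (Num.sqrt (\det (gram Omega x w))).
Local Notation sint := (surface_integral Omega x).

Lemma measurable_mesh_hull (T : mesh Omega x) (t : 'I_(mesh_card T)) :
  measurable (cV @^-1` hull (mesh_tri t)).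
Proof. by apply: measurable_hull; exact: mesh_nondeg. Qed.

Lemma measurable_Omega : measurable (cV @^-1` Omega).
Proof.
rewrite -(mesh_cover T0) preimage_bigcup; apply: fin_bigcup_measurable => // t _.
exact: measurable_mesh_hull.
Qed.

Lemma cV_mcvg (D : set (R * R)) p : mcvg (within D (nbhs p)) cV (cV p).
Proof.
move=> i j; apply: cvg_within_filter.
rewrite mxE.
rewrite (_ : (fun q => cV q i j) = (fun q => if i == 0 then q.1 else q.2)); last first.
  by apply/funext => q; rewrite mxE.
by case: (i == 0); [exact: cvg_fst | exact: cvg_snd].
Qed.

Lemma within_Omega (p : R * R) :
  \forall q \near within (cV @^-1` Omega) (nbhs p), Omega (cV q).
Proof. exact: near_withinT. Qed.

Lemma elt_cvg (p : R * R) : Omega (cV p) ->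
  elt (cV q) @[q --> within (cV @^-1` Omega) (nbhs p)] --> elt (cV p).
Proof.
move=> Op; apply: continuous_cvg; first exact: sqrt_continuous.
have hX : mcvg (within (cV @^-1` Omega) (nbhs p))
    (fun q => jacobian_in Omega x (cV q)) (jacobian_in Omega x (cV p)).
  exact: Dx_mcvg x_lip _ _ _ _ _ Op (within_Omega p) (@cV_mcvg _ p).
have hG : mcvg (within (cV @^-1` Omega) (nbhs p)) (fun q => gram Omega x (cV q))
    (gram Omega x (cV p)).
  exact: mcvgM (mcvg_tr hX) hX.
rewrite det_mx22E; under eq_fun do rewrite det_mx22E.
by apply: cvgB; apply: cvgM; exact: hG.
Qed.

Lemma measurable_integrand (g : 'cV[R]_2 -> R) :
  (forall p : R * R, Omega (cV p) ->
     g (cV q) @[q --> within (cV @^-1` Omega) (nbhs p)] --> g (cV p)) ->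
  measurable_fun (cV @^-1` Omega) (fun p => (g (cV p) * elt (cV p))%:E).
Proof.
move=> gc; apply/measurable_EFinP; apply: continuous_in_measurable => p Op.
by apply: cvgM; [exact: gc | exact: elt_cvg].
Qed.

Lemma measurable_cst_integrand c :
  measurable_fun (cV @^-1` Omega) (fun p => (c * elt (cV p))%:E).
Proof. by apply: (@measurable_integrand (fun=> c)) => p _; exact: cvg_cst. Qed.

Lemma open_tri_null (T : mesh Omega x) :
  let D := \big[setU/set0]_(t < mesh_card T) cV @^-1` open_tri (mesh_tri t) in
  [/\ measurable D, D `<=` cV @^-1` Omega & mu2 (cV @^-1` Omega `\` D) = 0].
Proof.
move=> D.
have mD : measurable D.
  by apply: bigsetU_measurable => t _; exact: measurable_open_tri.
split => //.
  rewrite /D -bigcup_seq => p [t _ ht]; apply: (@mesh_hull_sub _ _ _ _ T t).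
  by apply: open_tri_sub => //; exact: mesh_nondeg.
suff H : mu2.-negligible (cV @^-1` Omega `\` D).
  by apply/negligibleP; [apply: measurableD => //; exact: measurable_Omega | exact: H].
have H : mu2.-negligible (\big[setU/set0]_(t < mesh_card T)
    (cV @^-1` hull (mesh_tri t) `\` cV @^-1` open_tri (mesh_tri t))).
  elim/big_ind: _ => [|A B nA nB|t _]; first exact: negligible_set0.
    exact: negligibleU.
  by apply: hull_setD_null; exact: mesh_nondeg.
apply: negligibleS H.
rewrite /D -!bigcup_seq => p [/(mesh_hullP T) [t ht] nD].
  exists t; first by rewrite /= mem_index_enum.
by split => // ot; apply: nD; exists t => //; rewrite /= mem_index_enum.
Qed.

(** The hulls of a mesh may share edges, so they are first replaced by the open
    triangles, which are disjoint and miss only null sets. *)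
Lemma integral_mesh (T : mesh Omega x) (h : R * R -> \bar R) :
  measurable_fun (cV @^-1` Omega) h -> (forall p, Omega (cV p) -> (0 <= h p)%E) ->
  (\int[mu2]_(p in cV @^-1` Omega) h p =
   \sum_(t < mesh_card T) \int[mu2]_(p in cV @^-1` hull (mesh_tri t)) h p)%E.
Proof.
move=> mh h0; have [mD sD nD] := open_tri_null T.
set D := (X in measurable X) in mD sD nD.
have mO := measurable_Omega.
rewrite (@ge0_negligible_integral _ _ _ plane_measure _ (cV @^-1` Omega `\` D)) //;
  last exact: measurableD.
rewrite setDD (setIidr sD) /D.
rewrite (@ge0_integral_bigsetU _ _ _ plane_measure).
- apply: eq_bigr => t _.
  have mt := measurable_mesh_hull t.
  have mo := measurable_open_tri (mesh_tri t).
  have so : cV @^-1` open_tri (mesh_tri t) `<=` cV @^-1` hull (mesh_tri t).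
    by move=> p; apply: open_tri_sub; exact: mesh_nondeg.
  have st : cV @^-1` hull (mesh_tri t) `<=` cV @^-1` Omega.
    by move=> p; exact: mesh_hull_sub.
  have nt : mu2 (cV @^-1` hull (mesh_tri t) `\` cV @^-1` open_tri (mesh_tri t)) = 0.
    apply/negligibleP; first exact: measurableD.
    by apply: hull_setD_null; exact: mesh_nondeg.
  rewrite [RHS](@ge0_negligible_integral _ _ _ plane_measure _
    (cV @^-1` hull (mesh_tri t) `\` cV @^-1` open_tri (mesh_tri t))) //.
  + by rewrite setDD (setIidr so).
  + exact: measurableD.
  + exact: measurable_funS mh.
  + by move=> p /st; exact: h0.
- by move=> t; exact: measurable_open_tri.
- exact: index_enum_uniq.
- apply/trivIsetP => t t' _ _ tt'; apply/seteqP; split => // p [/= h1 h2].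
  have := mesh_disjoint tt' => /seteqP[+ _]; apply; split;
    apply: bary_gt0_interior => //; exact: mesh_nondeg.
- exact: measurable_funS mh.
- by move=> p /sD; exact: h0.
Qed.

Lemma sint_mesh (T : mesh Omega x) (g : 'cV[R]_2 -> R) :
  measurable_fun (cV @^-1` Omega) (fun p => (g (cV p) * elt (cV p))%:E) ->
  (forall w, Omega w -> 0 <= g w) ->
  sint Omega g = (\sum_(t < mesh_card T) sint (hull (mesh_tri t)) g)%E.
Proof.
move=> mg g0; apply: integral_mesh => // p Op.
by rewrite lee_fin mulr_ge0 ?g0.
Qed.

Lemma sint_cst (D : set 'cV[R]_2) (c : R) : measurable (cV @^-1` D) ->
  D `<=` Omega -> 0 <= c -> sint D (fun=> c) = (c%:E * sint D (fun=> 1%R))%E.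
Proof.
move=> mD sD c0; rewrite /surface_integral -ge0_integralZl //.
- by apply: eq_integral => p _; rewrite -EFinM mul1r.
- apply: (measurable_funS measurable_Omega _ (measurable_cst_integrand 1)) => p.
  exact: sD.
Qed.

Lemma sint_ge0 (D : set 'cV[R]_2) (g : 'cV[R]_2 -> R) :
  (forall w, D w -> 0 <= g w) -> (0 <= sint D g)%E.
Proof.
by move=> g0; apply: integral_ge0 => p Dp; rewrite lee_fin mulr_ge0 // g0.
Qed.

Lemma sint_le_add (D : set 'cV[R]_2) (g h : 'cV[R]_2 -> R) (c : R) :
  measurable (cV @^-1` D) -> D `<=` Omega ->
  measurable_fun (cV @^-1` Omega) (fun p => (g (cV p) * elt (cV p))%:E) ->
  measurable_fun (cV @^-1` Omega) (fun p => (h (cV p) * elt (cV p))%:E) ->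
  0 <= c -> (forall w, D w -> 0 <= g w) -> (forall w, D w -> 0 <= h w) ->
  (forall w, D w -> g w <= h w + c) ->
  (sint D g <= sint D h + c%:E * sint D (fun=> 1%R))%E.
Proof.
move=> mD sD mg mh c0 g0 h0 gh.
have mO := measurable_Omega.
have sub (f : R * R -> \bar R) : measurable_fun (cV @^-1` Omega) f ->
    measurable_fun (cV @^-1` D) f.
  by move=> mf; apply: measurable_funS mf => // p; exact: sD.
rewrite -sint_cst // /surface_integral -ge0_integralD //.
- apply: ge0_le_integral => //.
  + by move=> p Dp; rewrite lee_fin mulr_ge0 // g0.
  + exact: sub.
  + by apply: emeasurable_funD; apply: sub => //; exact: measurable_cst_integrand.
  + by move=> p Dp; rewrite -EFinD lee_fin -mulrDl ler_wpM2r // gh.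
- by move=> p Dp; rewrite lee_fin mulr_ge0 // h0.
- exact: sub.
- by move=> p Dp; rewrite lee_fin mulr_ge0.
- by apply: sub; exact: measurable_cst_integrand.
Qed.

(** Omega lies in a box and the entries of the Gram matrix are at most K^2. *)
Lemma sint1_fin : (sint Omega (fun=> 1%R) < +oo)%E.
Proof.
have [B B0 hB] := Omega_bounded T0.
have [K K0 hK] := Dx_bounded T0 x_lip.
have mO := measurable_Omega.
have eb w : Omega w -> elt w <= Num.sqrt (2 * K ^+ 4).
  move=> Ow; apply: ler_wsqrtr; rewrite det_mx22E.
  have G i j : `|gram Omega x w i j| <= K ^+ 2.
    apply: le_trans (normr_le_frob _ _ _) _; apply: le_trans (frobM _ _) _.
    by rewrite frob_tr expr2; apply: ler_pM; rewrite ?hK.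
  apply: le_trans (ler_norm _) _; apply: le_trans (ler_normB _ _) _.
  have -> : 2 * K ^+ 4 = K ^+ 2 * K ^+ 2 + K ^+ 2 * K ^+ 2 by ring.
  by rewrite !normrM lerD //; apply: ler_pM.
pose Box := `[- B, B]%classic `*` `[- B, B]%classic : set (R * R).
have sB : cV @^-1` Omega `<=` Box.
  move=> p /hB hp.
  have h1 := normr_le_frob (cV p) 0 0; have h2 := normr_le_frob (cV p) 1 0.
  rewrite !mxE /= in h1 h2.
  by split; rewrite /= in_itv /= -ler_norml (le_trans _ hp).
have mB : measurable Box by apply: measurableX; exact: measurable_itv.
have cst0 : (0 <= (Num.sqrt (2 * K ^+ 4))%:E)%E by rewrite lee_fin sqrtr_ge0.
apply: (@le_lt_trans _ _
  (\int[mu2]_(p in cV @^-1` Omega) cst (Num.sqrt (2 * K ^+ 4))%:E p)%E).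
  apply: ge0_le_integral => //.
  - exact: measurable_cst_integrand.
  - by move=> p Op; rewrite lee_fin mul1r eb.
rewrite integral_cst //.
apply: (@le_lt_trans _ _ ((Num.sqrt (2 * K ^+ 4))%:E * mu2 Box)%E).
  by apply: lee_wpmul2l => //; apply: le_measure => //; rewrite inE.
rewrite product_measure1E //; try exact: measurable_itv.
have fB : (lebesgue_measure (`[(- B)%R, B%R]%classic : set R) < +oo)%E.
  by rewrite lebesgue_measure_itv /=; case: ifP => // _; rewrite -EFinB ltry.
rewrite lte_mul_pinfty // lte_mul_pinfty //.
by rewrite ge0_fin_numE.
Qed.

End surface_integrals.

(** * Comparison of the energies *)

Lemma cvg_sqr (R : realType) (T : Type) (U : set_system T) {FU : Filter U}
    (f : T -> R) (l : R) :
  f t @[t --> U] --> l -> f t ^+ 2 @[t --> U] --> l ^+ 2.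
Proof. by move=> h; rewrite expr2; under eq_fun do rewrite expr2; exact: cvgM. Qed.

Section energies.
Variables (R : realType) (m n : nat) (Omega : set 'cV[R]_2) (x : 'cV[R]_2 -> 'cV[R]_m).
Variable T0 : mesh Omega x.
Hypothesis x_inj : set_inj Omega x.
Hypothesis x_diff : differentiable_in Omega x.
Hypothesis x_lip : exists L : R, lipschitz_with Omega (jacobian_in Omega x) id L.
Hypothesis x_rank : forall w, Omega w -> \rank (jacobian_in Omega x w) = 2%N.
Variables (N : set 'cV[R]_n) (CL : R).
Hypothesis CL_gt0 : 0 < CL.

Local Notation cV := (@cV_of_pair R).
Local Notation adm := (admissible Omega x N CL).
Local Notation sint := (surface_integral Omega x).
Local Notation elt w := (Num.sqrt (\det (gram Omega x w))).

Lemma sqr_frob_diff p q (A B : 'M[R]_(p, q)) a e :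
  frob B <= a -> frob (A - B) <= e ->
  frob A ^+ 2 <= frob B ^+ 2 + e * (a + a + e) /\
  frob B ^+ 2 <= frob A ^+ 2 + e * (a + a + e).
Proof.
move=> Ba ABe.
have e0 : 0 <= e by exact: le_trans (frob_ge0 _) ABe.
have h1 : frob A <= frob B + e.
  by rewrite -{1}(subrK B A) (le_trans (frobD _ _)) // addrC lerD2l.
have h2 : frob B <= frob A + e.
  rewrite -{1}(subKr A B) (le_trans (frobB _ _)) // lerD2l //.
have A0 := frob_ge0 A; have B0 := frob_ge0 B.
by split; nra.
Qed.

Lemma tgrad_sqr_cvg f (p : R * R) : adm f -> Omega (cV p) ->
  frob (tgrad Omega x f (cV q)) ^+ 2 @[q --> within (cV @^-1` Omega) (nbhs p)]
    --> frob (tgrad Omega x f (cV p)) ^+ 2.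
Proof.
move=> af Op.
set U := within _ _.
have FU : Filter U by exact: within_filter.
have OU : \forall q \near U, Omega (cV q) by exact: within_Omega.
have hx : mcvg U (fun q => x (cV q)) (x (cV p)).
  by apply: (mcvg_diff (x_jacobian x_diff Op)) => //; exact: cV_mcvg.
have h2 : CL * frob (x (cV q) - x (cV p)) @[q --> U] --> 0.
  rewrite -[X in _ --> X](mulr0 CL).
  by apply: cvgM; [exact: cvg_cst | exact: mcvg_frob_dist].
have h3 : \forall q \near U, 0 <= frob (tgrad Omega x f (cV q) - tgrad Omega x f (cV p))
    <= CL * frob (x (cV q) - x (cV p)).
  by apply: filterS OU => q Oq; rewrite frob_ge0 (adm_lip CL_gt0 af).
have hA : mcvg U (fun q => tgrad Omega x f (cV q)) (tgrad Omega x f (cV p)).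
  by apply: mcvg_frob0; exact: (squeeze_cvgr h3 (cvg_cst 0) h2).
by apply: cvg_sqr; exact: mcvg_frob.
Qed.

Lemma measurable_tgrad f : adm f ->
  measurable_fun (cV @^-1` Omega)
    (fun p => (frob (tgrad Omega x f (cV p)) ^+ 2 * elt (cV p))%:E).
Proof.
move=> af.
apply: (measurable_integrand x_lip (g := fun w => frob (tgrad Omega x f w) ^+ 2)).
by move=> p Op; exact: tgrad_sqr_cvg.
Qed.

Definition surface_area (D : set 'cV[R]_2) : R := fine (sint D (fun=> 1%R)).

Lemma surface_areaE D : measurable (cV @^-1` D) -> D `<=` Omega ->
  sint D (fun=> 1%R) = (surface_area D)%:E.
Proof.
move=> mD sD; rewrite /surface_area fineK // ge0_fin_numE; last first.
  by apply: sint_ge0 => w _; exact: ler01.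
apply: le_lt_trans (sint1_fin T0 x_lip).
apply: (@ge0_subset_integral _ _ _ plane_measure) => //.
- exact: measurable_Omega T0.
- exact: measurable_cst_integrand.
- by move=> p; exact: sD.
Qed.

Lemma surface_area_ge0 D : 0 <= surface_area D.
Proof. by apply: fine_ge0; apply: sint_ge0 => w _; exact: ler01. Qed.

Definition disc_energy (T : mesh Omega x) (f : 'cV[R]_m -> 'cV[R]_n) : R :=
  \sum_(t < mesh_card T) 2^-1 * (frob (disc_grad t f) ^+ 2
     * surface_area (hull (mesh_tri t))).

Lemma dirichlet_hE (T : mesh Omega x) f : dirichlet_h T f = (disc_energy T f)%:E.
Proof.
rewrite /dirichlet_h /disc_energy -sumEFin; apply: eq_bigr => t _.
have mt := measurable_mesh_hull t.
rewrite (sint_cst T0 x_lip) ?sqr_ge0 //; last exact: mesh_hull_sub.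
by rewrite surface_areaE //; exact: mesh_hull_sub.
Qed.

Lemma disc_energy_ge0 (T : mesh Omega x) f : 0 <= disc_energy T f.
Proof.
by apply: sumr_ge0 => t _; rewrite !mulr_ge0 ?sqr_ge0 ?surface_area_ge0.
Qed.

Lemma dirichlet_mesh (T : mesh Omega x) f : adm f ->
  dirichlet Omega x f = (\sum_(t < mesh_card T) (2^-1)%:E *
    sint (hull (mesh_tri t)) (fun w => frob (tgrad Omega x f w) ^+ 2)%R)%E.
Proof.
move=> af; rewrite /dirichlet (sint_mesh T0 T) ?ge0_sume_distrr //.
- by move=> t _; apply: sint_ge0 => w _; exact: sqr_ge0.
- exact: measurable_tgrad.
- by move=> w _; exact: sqr_ge0.
Qed.

Lemma sum_surface_area (T : mesh Omega x) (c : R) : 0 <= c ->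
  (\sum_(t < mesh_card T) (2^-1)%:E * (c%:E * sint (hull (mesh_tri t)) (fun=> 1%R)))%E
  = (2^-1 * (c * surface_area Omega))%:E.
Proof.
move=> c0.
have h0 t : (0 <= sint (hull (@mesh_tri _ _ _ _ T t)) (fun=> 1%R))%E.
  by apply: sint_ge0 => w _; exact: ler01.
rewrite -ge0_sume_distrr; last by move=> t _; rewrite mule_ge0.
rewrite -ge0_sume_distrr // -(sint_mesh T0 T) //.
- by rewrite surface_areaE //; exact: measurable_Omega T0.
- exact: measurable_cst_integrand.
Qed.

(** With e the error of the gradients and a a bound for tgrad f, the integrands
    differ by at most e (a + a + e), whatever f is. *)
Lemma energy_close : exists2 C : R, 0 <= C & exists2 a : R, 0 <= a &
  forall (T : mesh Omega x) f, adm f ->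
  let e := C * mesh_ratio T in
  let D := (2^-1 * (e * (a + a + e) * surface_area Omega))%:E in
  (dirichlet_h T f <= dirichlet Omega x f + D)%E /\
  (dirichlet Omega x f <= dirichlet_h T f + D)%E.
Proof.
have [C C0 hC] := disc_grad_consistent T0 x_inj x_diff x_lip x_rank N CL_gt0.
have [a a0 ha] := tgrad_bounded T0 x_diff x_lip x_rank N CL_gt0.
exists C => //; exists a => // T f af e.
have e0 : 0 <= e by rewrite mulr_ge0 // bigmax_ge_id.
have d0 : 0 <= e * (a + a + e) by rewrite mulr_ge0 // !addr_ge0.
have mO := measurable_Omega T0.
have mt (t : 'I_(mesh_card T)) := measurable_mesh_hull t.
have st (t : 'I_(mesh_card T)) := @mesh_hull_sub _ _ _ _ T t.
rewrite -(sum_surface_area T d0) (dirichlet_mesh T af) /dirichlet_h.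
have key (t : 'I_(mesh_card T)) w : hull (mesh_tri t) w ->
    frob (disc_grad t f) ^+ 2 <= frob (tgrad Omega x f w) ^+ 2 + e * (a + a + e) /\
    frob (tgrad Omega x f w) ^+ 2 <= frob (disc_grad t f) ^+ 2 + e * (a + a + e).
  by move=> hw; apply: sqr_frob_diff; [apply: ha => //; exact: st hw | exact: hC].
have half0 : (0 <= (2^-1)%:E :> \bar R)%E by rewrite lee_fin invr_ge0.
have h1 t : (0 <= sint (hull (@mesh_tri _ _ _ _ T t)) (fun=> 1%R))%E.
  by apply: sint_ge0 => w _; exact: ler01.
rewrite -!big_split /=; split; apply: lee_sum => t _;
  rewrite -ge0_muleDr ?mule_ge0 ?lee_fin //;
  try (by apply: sint_ge0 => w _; exact: sqr_ge0);
  apply: lee_wpmul2l => //.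
- apply: (sint_le_add T0 x_lip) => //.
  + exact: measurable_cst_integrand.
  + exact: measurable_tgrad.
  + by move=> w _; exact: sqr_ge0.
  + by move=> w _; exact: sqr_ge0.
  + by move=> w hw; have [] := key t w hw.
- apply: (sint_le_add T0 x_lip) => //.
  + exact: measurable_tgrad.
  + exact: measurable_cst_integrand.
  + by move=> w _; exact: sqr_ge0.
  + by move=> w _; exact: sqr_ge0.
  + by move=> w hw; have [] := key t w hw.
Qed.

End energies.

(** * Existence of discrete minimizers *)

Section minimizer.
Variables (R : realType) (m n : nat) (Omega : set 'cV[R]_2) (x : 'cV[R]_2 -> 'cV[R]_m).
Variable T : mesh Omega x.
Hypothesis x_inj : set_inj Omega x.
Hypothesis x_diff : differentiable_in Omega x.
Hypothesis x_lip : exists L : R, lipschitz_with Omega (jacobian_in Omega x) id L.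
Hypothesis x_rank : forall w, Omega w -> \rank (jacobian_in Omega x w) = 2%N.
Variables (N : set 'cV[R]_n) (CL : R).
Hypothesis CL_gt0 : 0 < CL.

Local Notation Dx := (jacobian_in Omega x).
Local Notation adm := (admissible Omega x N CL).

(** The estimate is available along segments in Omega only, but near w these
    reach every point of Omega. *)
Lemma has_jacobian_of_taylor (u : 'cV[R]_2 -> 'cV[R]_n)
    (J : 'cV[R]_2 -> 'M[R]_(n, 2)) K w :
  0 <= K ->
  (forall w', segment_in Omega w w' ->
     frob (u w' - u w - J w *m (w' - w)) <= K * frob (w' - w) ^+ 2) ->
  has_jacobian_in Omega u w (J w).
Proof.
move=> K0 h e e0.
have K1 : 0 < K + 1 by rewrite ltr_wpDl.
have h1 := near_segment T w; have h2 := near_frob w (divr_gt0 e0 K1).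
rewrite /prop_near1 /within /=; apply: filterS2 h1 h2 => w' seg hd Ow'.
apply: le_trans (h _ (seg Ow')) _; rewrite expr2 mulrA ler_wpM2r //.
rewrite ltr_pdivlMr // in hd; apply: le_trans (ltW hd); rewrite mulrC.
by rewrite ler_wpM2l // lerDl.
Qed.

Lemma eq_has_jacobian_in k (u u' : 'cV[R]_2 -> 'cV[R]_k) w J :
  Omega w -> (forall p, Omega p -> u p = u' p) ->
  has_jacobian_in Omega u w J -> has_jacobian_in Omega u' w J.
Proof.
move=> Ow E h e e0.
have h' : \forall p \near w, Omega p ->
  frob (u p - u w - J *m (p - w)) <= e * frob (p - w) by exact: h.
rewrite /prop_near1 /within /=; apply: filterS h' => p hp Op.
by rewrite -(E p Op) -(E w Ow); exact: hp.
Qed.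

(** Values and tangential gradients are bounded, so they converge along U, to u
    and A.  The uniform Taylor estimate survives the limit and makes A Dx the
    derivative of u; the Lipschitz condition is closed.  For the range, points
    z_k of Omega realizing a given value accumulate in Omega: for u w in N they
    are preimages of f_k (x w) under the one map f 0; conversely, for y in N,
    equicontinuity lets f_k (x z_k) = y pass to the limit. *)
Lemma adm_compact (f : nat -> 'cV[R]_m -> 'cV[R]_n) (U : set_system nat) :
  UltraFilter U -> (forall k, adm (f k)) ->
  exists2 g, adm g & forall w, Omega w -> mcvg U (fun k => f k (x w)) (g (x w)).
Proof.
move=> UU af.
have hF : adm !=set0 by exists (f 0%N).
have [BN BN0 hBN] := N_bounded T hF.
have [a a0 ha] := tgrad_bounded T x_diff x_lip x_rank N CL_gt0.
have [Xm Xm0 hXm] := Dx_bounded T x_lip.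
have [K K0 hK] := adm_taylor T x_diff x_lip x_rank N CL_gt0.
have /choice [u hu] : forall w, exists y, Omega w -> mcvg U (fun k => f k (x w)) y.
  move=> w; have [Ow|nO] := pselect (Omega w); last by exists 0.
  have [|y hy] := @mcvg_ultra _ _ U UU _ _ (fun k => f k (x w)) BN; last by exists y.
  by apply: nearW => k; apply: hBN; exact: adm_range (af k) Ow.
have /choice [A hA] : forall w, exists A, Omega w ->
    mcvg U (fun k => tgrad Omega x (f k) w) A.
  move=> w; have [Ow|nO] := pselect (Omega w); last by exists 0.
  have [|y hy] := @mcvg_ultra _ _ U UU _ _ (fun k => tgrad Omega x (f k) w) a;
    last by exists y.
  by apply: nearW => k; exact: ha.
pose J w := A w *m Dx w.
have hJ w : Omega w -> mcvg U (fun k => jacobian_in Omega (f k \o x) w) (J w).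
  move=> Ow; have -> : (fun k => jacobian_in Omega (f k \o x) w) =
     (fun k => tgrad Omega x (f k) w *m Dx w).
    by apply/funext => k; rewrite tgrad_mul_Dx.
  by apply: mcvgM; [exact: hA | exact: mcvg_cst].
pose xinv y := xget 0 [set w | Omega w /\ x w = y].
have xinvK w : Omega w -> xinv (x w) = w.
  move=> Ow; have [Ow' E] : [set w' | Omega w' /\ x w' = x w] (xinv (x w)).
    by apply: (xgetPex 0); exists w.
  by apply: x_inj; rewrite ?inE.
pose g := u \o xinv.
have gx w : Omega w -> g (x w) = u w by move=> Ow; rewrite /g /= xinvK.
have taylor w w' : segment_in Omega w w' ->
    frob (u w' - u w - J w *m (w' - w)) <= K * frob (w' - w) ^+ 2.
  move=> seg; have Ow := segment_in_l seg; have Ow' := segment_in_r seg.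
  apply: (@mcvg_le _ _ U _ _ _ (fun k => f k (x w') - f k (x w)
    - jacobian_in Omega (f k \o x) w *m (w' - w)) _ (fun=> K * frob (w' - w) ^+ 2)).
  - apply: mcvgB; first by apply: mcvgB; exact: hu.
    by apply: mcvgM; [exact: hJ | exact: mcvg_cst].
  - exact: cvg_cst.
  - by apply: nearW => k; exact: hK.
have gjac w : Omega w -> has_jacobian_in Omega (g \o x) w (J w).
  move=> Ow; apply: (@eq_has_jacobian_in _ u) => //.
    by move=> p Op; rewrite /= gx.
  by apply: (has_jacobian_of_taylor K0) => // w' seg; exact: taylor.
have gtgrad w : Omega w -> tgrad Omega x g w = A w.
  move=> Ow; rewrite tgradE (mesh_jacobian_unique T Ow (gjac w Ow)).
  have h1 : mcvg U (fun k => tgrad Omega x (f k) w) (J w *m param_pinv Omega x w).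
    have -> : (fun k => tgrad Omega x (f k) w) =
      (fun k => jacobian_in Omega (f k \o x) w *m param_pinv Omega x w).
      by apply/funext => k; rewrite tgradE.
    by apply: mcvgM; [exact: hJ | exact: mcvg_cst].
  exact: mcvg_unique h1 (hA w Ow).
exists g; last by move=> w Ow; rewrite gx //; exact: hu.
split.
- by move=> w Ow; exists (J w); exact: gjac.
- have range_sub : (u @` Omega) `<=` N.
    move=> _ [w Ow <-].
    have [_ imf _] := af 0%N.
    have /choice [z hz] : forall k, exists z, Omega z /\ f 0%N (x z) = f k (x w).
      move=> k; have : N (f k (x w)) by exact: adm_range (af k) Ow.
      by rewrite -imf => -[_ [z Oz <-] E]; exists z.
    have Oz : \forall k \near U, Omega (z k) by apply: nearW => k; case: (hz k).
    have [z0 Oz0 hz0] := mesh_ultra T Oz.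
    have c1 : mcvg U (fun k => f 0%N (x (z k))) (f 0%N (x z0)).
      exact: mcvg_diff (adm_jacobian (af 0%N) Oz0) Oz hz0.
    have c2 : mcvg U (fun k => f 0%N (x (z k))) (u w).
      have -> : (fun k => f 0%N (x (z k))) = (fun k => f k (x w)).
        by apply/funext => k; case: (hz k).
      exact: hu.
    by rewrite -(mcvg_unique c1 c2); exact: adm_range (af 0%N) Oz0.
  have range_sup : N `<=` (u @` Omega).
    move=> y Ny.
    have /choice [z hz] : forall k, exists z, Omega z /\ f k (x z) = y.
      move=> k; have [_ imf _] := af k; move: Ny; rewrite -imf.
      by move=> [_ [z Oz <-] E]; exists z.
    have Oz : \forall k \near U, Omega (z k) by apply: nearW => k; case: (hz k).
    have [z0 Oz0 hz0] := mesh_ultra T Oz.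
    exists z0 => //.
    have seg : \forall k \near U, segment_in Omega z0 (z k).
      have s0 : \forall k \near U, Omega (z k) -> segment_in Omega z0 (z k).
        exact: mcvg_nbhs hz0 (near_segment T z0).
      by apply: filterS2 s0 Oz => k; exact.
    have d0 : frob (z k - z0) @[k --> U] --> 0 by exact: mcvg_frob_dist.
    have b0 : (a * Xm) * frob (z k - z0) + K * (frob (z k - z0) * frob (z k - z0))
        @[k --> U] --> 0.
      have -> : (0 : R) = (a * Xm) * 0 + K * (0 * 0) by rewrite !mulr0 addr0.
      apply: cvgD; first by apply: cvgM => //; exact: cvg_cst.
      by apply: cvgM; [exact: cvg_cst | exact: cvgM].
    have b1 : \forall k \near U, 0 <= frob (f k (x z0) - y) <=
        (a * Xm) * frob (z k - z0) + K * (frob (z k - z0) * frob (z k - z0)).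
      apply: filterS seg => k sk; rewrite frob_ge0 /=.
      have [Ozk <-] := hz k; rewrite frobBC.
      rewrite -(subrK (jacobian_in Omega (f k \o x) z0 *m (z k - z0))
        (f k (x (z k)) - f k (x z0))) addrC.
      apply: le_trans (frobD _ _) _; rewrite addrC addrC lerD //; last first.
        by rewrite -expr2; exact: hK.
      apply: le_trans (frobM _ _) _; rewrite ler_wpM2r //.
      rewrite -(tgrad_mul_Dx x_rank _ Oz0); apply: le_trans (frobM _ _) _.
      by apply: ler_pM; rewrite ?ha ?hXm.
    have c1 : mcvg U (fun k => f k (x z0)) y.
      by apply: mcvg_frob0; exact: (squeeze_cvgr b1 (cvg_cst 0) b0).
    exact: mcvg_unique (hu z0 Oz0) c1.
  apply/seteqP; split.
    by move=> _ [_ [w Ow <-] <-]; apply: range_sub; exists w => //; rewrite gx.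
  move=> y /range_sup [w Ow <-]; exists (x w); first by exists w.
  by rewrite gx.
- apply/(tgrad_lip_constP _ _ CL_gt0) => w w' Ow Ow'; rewrite !gtgrad //.
  apply: (@mcvg_le _ _ U _ _ _ (fun k => tgrad Omega x (f k) w - tgrad Omega x (f k) w')
    _ (fun=> CL * frob (x w - x w'))).
  - by apply: mcvgB; exact: hA.
  - exact: cvg_cst.
  - by apply: nearW => k; exact: adm_lip.
Qed.

Lemma disc_energy_minimizer : adm !=set0 -> exists2 g, adm g &
  forall h, adm h -> disc_energy T g <= disc_energy T h.
Proof.
move=> [f0 af0].
pose E := [set disc_energy T f | f in adm].
have E0 : has_inf E.
  split; first by exists (disc_energy T f0), f0.
  by exists 0 => _ [f _ <-]; exact: disc_energy_ge0.
have lbE h : adm h -> inf E <= disc_energy T h.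
  by move=> ah; apply: ge_inf; [case: E0 | exists h].
have /choice [f hf] : forall k : nat, exists f,
    adm f /\ disc_energy T f <= inf E + k.+1%:R^-1.
  move=> k; have k0 : 0 < k.+1%:R^-1 :> R by rewrite invr_gt0.
  by have [_ [f af <-] /ltW hf] := inf_adherent k0 E0; exists f.
have [U [UU sU]] := ultraFilterLemma eventually_filter.
have [|g ag hg] := adm_compact UU (f := f); first by move=> k; case: (hf k).
exists g => // h ah; apply: le_trans (lbE h ah).
have c1 : disc_energy T (f k) @[k --> U] --> disc_energy T g.
  apply: cvg_sumr => t; apply: cvgM; first exact: cvg_cst.
  apply: cvgM; last exact: cvg_cst.
  apply: cvg_sqr; apply: mcvg_frob; rewrite /disc_grad mul_tr_bary_mx.
  under eq_fun do rewrite mul_tr_bary_mx.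
  apply: mcvg_sum => l; apply: mcvgM; last exact: mcvg_cst.
  by apply: hg; apply: (@mesh_hull_sub _ _ _ _ T t); exact: hull_vertex.
have c2 : inf E + k.+1%:R^-1 @[k --> U] --> inf E.
  rewrite -[X in _ --> X]addr0; apply: cvgD; first exact: cvg_cst.
  by apply: cvg_trans (@cvg_harmonic R); apply: cvg_app.
rewrite -subr_le0; apply: (cvgr_to_le (cvgB c1 c2)).
by apply: nearW => k; rewrite /= subr_le0; case: (hf k).
Qed.

End minimizer.

(** * Convergence of the minimal energies *)

Section convergence.
Variables (R : realType) (m n : nat) (Omega : set 'cV[R]_2) (x : 'cV[R]_2 -> 'cV[R]_m).

Lemma h_V_to0_filter (I : Type) (T : I -> mesh Omega x) : Filter (h_V_to0 T).
Proof.
apply: filter_from_filter; first by exists 1; exact: ltr01.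
move=> d e d0 e0; exists (Num.min d e); first by rewrite /= lt_min d0.
by move=> i /=; rewrite lt_min => /andP[].
Qed.

Lemma ereal_inf_le_add (X : Type) (A : set X) (u v : X -> \bar R) (D : R) :
  (forall f, A f -> (u f <= v f + D%:E)%E) ->
  (ereal_inf [set u f | f in A] <= ereal_inf [set v f | f in A] + D%:E)%E.
Proof.
move=> h; rewrite -leeBlDr //; apply: le_ereal_inf_tmp => _ [f Af <-].
rewrite leeBlDr //; apply: le_trans (h f Af).
by apply: ereal_inf_lbound; exists f.
Qed.

End convergence.

Theorem theorem4p2 (R : realType) (m n : nat) (hm : (2 <= m)%N)
    (Omega : set 'cV[R]_2) (x : 'cV[R]_2 -> 'cV[R]_m)
    (x_inj : set_inj Omega x)
    (x_diff : differentiable_in Omega x)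
    (x_lip : exists L : R, lipschitz_with Omega (jacobian_in Omega x) id L)
    (x_rank : forall w, Omega w -> \rank (jacobian_in Omega x w) = 2%N)
    (N : set 'cV[R]_n) (CL : R) (hCL : 0 < CL)
    (I : Type) (T : I -> mesh Omega x)
    (hT : mesh_ratio (T i) @[i --> h_V_to0 T] --> (0 : R)) :
  (forall i : I, admissible Omega x N CL !=set0 ->
     exists2 f, admissible Omega x N CL f &
       forall g, admissible Omega x N CL g ->
         (dirichlet_h (T i) f <= dirichlet_h (T i) g)%E) /\
  (ereal_inf [set dirichlet_h (T i) f | f in admissible Omega x N CL]
     @[i --> h_V_to0 T] -->
   ereal_inf [set dirichlet Omega x f | f in admissible Omega x N CL]).
Proof.
split.
  move=> i hF.
  have [g ag hg] := disc_energy_minimizer (T i) x_inj x_diff x_lip x_rank hCL hF.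
  by exists g => // h ah; rewrite !(dirichlet_hE (T i)) // lee_fin; exact: hg.
have FF := h_V_to0_filter T.
(* One mesh of the family supplies the constants; if there is none, the empty set
   belongs to the filter and every limit statement holds. *)
have [[i0 _]|nI] := pselect (exists i : I, True); last first.
  by move=> A _; exists 1; [exact: ltr01 | move=> i; exfalso; apply: nI; exists i].
have [[f0 af0]|hF] := pselect (admissible Omega x N CL !=set0); last first.
  have E0 : admissible Omega x N CL = set0.
    by apply/seteqP; split => // f af; apply: hF; exists f.
  rewrite E0 image_set0.
  by under eq_fun do rewrite image_set0; exact: cvg_cst.
have [C C0 [a a0 close]] := energy_close (T i0) x_inj x_diff x_lip x_rank N hCL.
pose D i : R := 2^-1 * ((C * mesh_ratio (T i)) * (a + a + C * mesh_ratio (T i))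
  * surface_area Omega x Omega).
have D0 : D i @[i --> h_V_to0 T] --> (0 : R).
  have -> : (0 : R) = 2^-1 * ((C * 0) * (a + a + C * 0) * surface_area Omega x Omega).
    by rewrite mulr0 !mul0r mulr0.
  have Ccvg : C * mesh_ratio (T i) @[i --> h_V_to0 T] --> C * 0.
    by apply: cvgM => //; exact: cvg_cst.
  apply: cvgM; first exact: cvg_cst.
  apply: cvgM; last exact: cvg_cst.
  by apply: cvgM => //; apply: cvgD => //; exact: cvg_cst.
set E := ereal_inf [set dirichlet Omega x f | f in _].
have up i : (ereal_inf [set dirichlet_h (T i) f | f in admissible Omega x N CL]
    <= E + (D i)%:E)%E.
  by apply: ereal_inf_le_add => f af; have [] := close (T i) f af.
have lo i : (E <=
    ereal_inf [set dirichlet_h (T i) f | f in admissible Omega x N CL] + (D i)%:E)%E.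
  by apply: ereal_inf_le_add => f af; have [] := close (T i) f af.
have Efin : E \is a fin_num.
  rewrite ge0_fin_numE.
    apply: (@le_lt_trans _ _ (dirichlet Omega x f0)).
      by apply: ereal_inf_lbound; exists f0.
    have [_] := close (T i0) f0 af0; move/le_lt_trans; apply.
    by rewrite (dirichlet_hE (T i0)) // -EFinD ltry.
  apply: le_ereal_inf_tmp => _ [f af <-]; apply: mule_ge0.
    by rewrite lee_fin invr_ge0.
  by apply: sint_ge0 => w _; exact: sqr_ge0.
rewrite -(fineK Efin); set e := fine E.
have EE : E = e%:E by rewrite fineK.
have h3 : \forall i \near h_V_to0 T, ((e - D i)%:E <=
    ereal_inf [set dirichlet_h (T i) f | f in admissible Omega x N CL] <= (e + D i)%:E)%E.
  apply: nearW => i; rewrite EFinB leeBlDr // -EE lo /=.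
  by rewrite EFinD -EE up.
apply: (squeeze_cvge h3).
- apply: cvg_EFin; first exact: nearW.
  by rewrite -[X in _ --> X]subr0; apply: cvgB => //; exact: cvg_cst.
- apply: cvg_EFin; first exact: nearW.
  by rewrite -[X in _ --> X]addr0; apply: cvgD => //; exact: cvg_cst.
Qed.
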